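(* The problem of computing, for a given string $S$, a minimum-cardinality $2$-sharp attractor of $S$ is solvable in polynomial time.
   Context: A $k$-sharp attractor of a string $S\in\Sigma^n$ is a set $\Gamma\subseteq[1..n]$ such that every substring $S[i..j]$ with $j-i+1=k$ has an occurrence $S[i'..j']=S[i..j]$ with $j''\in[i'..j']$ for some $j''\in\Gamma$. *)

(* Defs.v *)
From mathcomp Require Import all_boot finmap.

Set Implicit Arguments.
Unset Strict Implicit.
Unset Printing Implicit Defensive.

(* Positions are 1-based: [substring S i j] is S[i..j], for
   1 <= i <= j <= size S. *)
Definition substring (T : Type) (S : seq T) (i j : nat) : seq T :=
  drop i.-1 (take j S).

Definition sharp_attractor (T : Type) (k : nat) (S : seq T)
    (Gamma : {fset nat}) : Prop :=
  (forall g : nat, g \in Gamma -> 1 <= g <= size S) /\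
  (forall i j : nat, 1 <= i -> i <= j -> j <= size S -> j - i + 1 = k ->
     exists i' j' : nat,
       [/\ 1 <= i', i' <= j', j' <= size S,
           substring S i' j' = substring S i j
         & exists2 j'' : nat, j'' \in Gamma & i' <= j'' <= j']).

Definition minimum_sharp_attractor (T : Type) (k : nat) (S : seq T)
    (Gamma : {fset nat}) : Prop :=
  sharp_attractor k S Gamma /\
  (forall Gamma' : {fset nat},
     sharp_attractor k S Gamma' -> #|` Gamma| <= #|` Gamma'|).

(* Random access machine with a read-only, randomly accessible input, an
   append-only output, and registers indexed by nat holding natural numbers.
   Every instruction costs one time unit.  As the only arithmetic is addition
   and truncated subtraction, the maximal bit length of inputs and register contents grows
   by O(1) per step, so this unit cost is polynomially related to Turing machine
   time (Cook-Reckhow 1973; Papadimitriou, Computational Complexity,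
   Section 2.6).  In the table, [a] is the content of register a. *)
Inductive instr : Type :=
| Iconst of nat & nat        (* Iconst r c     r := c                      *)
| Imove of nat & nat         (* Imove r a      r := [a]                    *)
| Iadd of nat & nat & nat    (* Iadd r a b     r := [a] + [b]              *)
| Isub of nat & nat & nat    (* Isub r a b     r := [a] - [b], truncated   *)
| Iload of nat & nat         (* Iload r a      r := [[a]]                  *)
| Istore of nat & nat        (* Istore a b     register [a] := [b]         *)
| Ilen of nat                (* Ilen r         r := length of the input    *)
| Iread of nat & nat         (* Iread r a      r := input item [a] (from 0) *)
| Iwrite of nat              (* Iwrite a       append [a] to the output    *)
| Ijump of nat               (* Ijump l        go to instruction l         *)
| Ijumplt of nat & nat & nat (* Ijumplt a b l  go to l if [a] < [b]        *)
| Ihalt.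

Definition program : Type := seq instr.

Record config : Type :=
  Config { pc : nat; regs : nat -> nat; output : seq nat }.

Definition init : config := Config 0 (fun _ => 0) [::].

Definition upd (m : nat -> nat) (r v : nat) : nat -> nat :=
  fun x => if x == r then v else m x.

(* Leaving the program also halts. *)
Definition current (p : program) (c : config) : instr := nth Ihalt p (pc c).

Definition halted (p : program) (c : config) : bool :=
  if current p c is Ihalt then true else false.

Definition step (p : program) (input : seq nat) (c : config) : config :=
  let: Config i m o := c in
  match current p c with
  | Iconst r v => Config i.+1 (upd m r v) o
  | Imove r a => Config i.+1 (upd m r (m a)) o
  | Iadd r a b => Config i.+1 (upd m r (m a + m b)) o
  | Isub r a b => Config i.+1 (upd m r (m a - m b)) o
  | Iload r a => Config i.+1 (upd m r (m (m a))) o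
  | Istore a b => Config i.+1 (upd m (m a) (m b)) o
  | Ilen r => Config i.+1 (upd m r (size input)) o
  | Iread r a => Config i.+1 (upd m r (nth 0 input (m a))) o
  | Iwrite a => Config i.+1 m (rcons o (m a))
  | Ijump l => Config l m o
  | Ijumplt a b l => Config (if m a < m b then l else i.+1) m o
  | Ihalt => c
  end.

Definition run (p : program) (input : seq nat) (t : nat) : config :=
  iter t (step p input) init.

(* Total bit length of the input numbers, 0 counting for one bit. *)
Definition input_size (input : seq nat) : nat :=
  \sum_(s <- input) (trunc_log 2 s).+1.

Definition polytime_solvable (R : seq nat -> seq nat -> Prop) : Prop :=
  exists (p : program) (c d : nat), forall input : seq nat,
    exists t : nat,
      [/\ t <= c * input_size input ^ d + c,
          halted p (run p input t)
        & R input (output (run p input t))].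

(* Letters are arbitrary natural numbers, so the alphabet is not fixed: for an
   alphabet of constant size the problem could be solved by brute force over
   the boundedly many length-k substrings.  The solution is written as a
   duplicate-free list of positions, in any order. *)
Definition compute_minimum_sharp_attractor (k : nat) (S out : seq nat) : Prop :=
  uniq out /\ minimum_sharp_attractor k S [fset x in out]%fset.

(* Main.v *)
Require Import Defs.
From mathcomp Require Import all_boot finmap.
From mathcomp Require Import zify.

Set Implicit Arguments.
Unset Strict Implicit.
Unset Printing Implicit Defensive.

(** Take the distinct bigrams of S as vertices; a position of S that lies in two bigrams joins
    them, and a 2-sharp attractor is an edge cover of this graph. Hence a minimum attractor has
    (number of bigrams) - (size of a maximum matching) elements, and the graph need not be
    bipartite.

    Maximum matchings are found without blossoms, by an algorithmic form of Gallai's lemma. A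
    matching is an involution of the vertices whose fixed points are the unmatched vertices. For
    all quadruples X of vertices the program keeps the best known matching that avoids X, and
    improves these by adding an edge between two unmatched vertices and by exchanging two known
    matchings along an alternating path. The table can improve only polynomially often. When it is
    stable, let f be the least number of unmatched vertices of a known matching, D the set of
    vertices left unmatched by some known matching with f unmatched vertices, and A the set of
    neighbours of D outside D. Then every component of D contains at most one vertex that an
    optimal known matching leaves unmatched or matches into A, and these components with A form a
    Tutte-Berge certificate of maximality.

    The program is written in a language with arrays, whose only loop repeats its body
    (length of the input) + 1 times, so that every program runs in polynomial time. *)

(** * Matchings as involutions *)

Lemma card_setU_pair (V : finType) (X : {set V}) a b : #|X :|: [set a; b]| <= #|X| + 2.
Proof. by rewrite (leq_trans (leq_card_setU _ _)) // leq_add2l cards2; case: (_ != _). Qed.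

Section Involutions.
Variable V : finType.
Implicit Types (m n : {ffun V -> V}) (A C X Y : {set V}).

Definition unmatched m : {set V} := [set v | m v == v].

Definition switch C m n : {ffun V -> V} := [ffun v => if v \in C then m v else n v].

Definition restrict X m : {ffun V -> V} :=
  [ffun v => if (v \in X) || (m v \in X) then v else m v].

Definition add_edge m u v : {ffun V -> V} :=
  [ffun x => if x == u then v else if x == v then u else m x].

Lemma unmatchedP m v : reflect (m v = v) (v \in unmatched m).
Proof. by rewrite inE; apply: eqP. Qed.

Lemma card_involution (r : V -> nat) m A : injective r -> involutive m ->
  (forall v, v \in A -> m v \in A) ->
  #|unmatched m :&: A| + 2 * #|[set v in A | r v < r (m v)]| = #|A|.
Proof.
move=> r_inj mK Am; pose L := [set v in A | r v < r (m v)].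
have mA v : (m v \in A) = (v \in A) by apply/idP/idP => /Am; rewrite ?mK.
have -> : 2 * #|L| = #|L :|: m @^-1: L|.
  rewrite cardsU (_ : L :&: m @^-1: L = set0) ?cards0 ?subn0; last first.
    by apply/setP => v; rewrite !inE mK; case: ltngtP; rewrite ?andbF.
  by rewrite card_preimset ?mul2n ?addnn //; apply: inv_inj.
have -> : L :|: m @^-1: L = A :\: unmatched m.
  by apply/setP => v; rewrite !inE mK mA -andb_orr -neq_ltn (inj_eq r_inj) eq_sym andbC.
by rewrite setIC cardsID.
Qed.

Lemma odd_unmatchedI m A : involutive m -> (forall v, v \in A -> m v \in A) ->
  odd #|unmatched m :&: A| = odd #|A|.
Proof.
move=> mK Am; have rank_inj : injective (fun v : V => enum_rank v : nat).
  by move=> u v /val_inj/enum_rank_inj.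
by rewrite -(card_involution rank_inj mK Am) oddD mul2n odd_double addbF.
Qed.

Lemma odd_unmatched m : involutive m -> odd #|unmatched m| = odd #|V|.
Proof. by move=> mK; rewrite -cardsT -(odd_unmatchedI mK (A := setT)) ?setIT // => v. Qed.

Lemma even_matched_set m A : involutive m ->
  (forall v, v \in A -> m v \in A) -> (forall v, v \in A -> m v != v) -> ~~ odd #|A|.
Proof.
move=> mK Am Afix; rewrite -(odd_unmatchedI mK Am) (_ : _ :&: A = set0) ?cards0 //.
by apply/setP => v; rewrite !inE; case: (boolP (v \in A)) => [/Afix/negPf->|]; rewrite ?andbF.
Qed.

Lemma card_unmatched_switch C m n :
  #|unmatched (switch C m n)| + #|unmatched n :&: C| = #|unmatched n| + #|unmatched m :&: C|.
Proof.
rewrite -(cardsID C (unmatched (switch C m n))) -(cardsID C (unmatched n)).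
have -> : unmatched (switch C m n) :&: C = unmatched m :&: C.
  by apply/setP => v; rewrite !inE ffunE; case: (v \in C); rewrite ?andbF.
have -> : unmatched (switch C m n) :\: C = unmatched n :\: C.
  by apply/setP => v; rewrite !inE ffunE; case: (v \in C).
lia.
Qed.

Lemma mem_unmatched_switch C m n v :
  (v \in unmatched (switch C m n)) = (v \in unmatched (if v \in C then m else n)).
Proof. by rewrite !inE ffunE; case: ifP. Qed.

Lemma restrict_avoids X m : X \subset unmatched (restrict X m).
Proof. by apply/subsetP => v vX; apply/unmatchedP; rewrite ffunE vX. Qed.

Lemma restrict_id X m : involutive m -> X \subset unmatched m -> restrict X m = m.
Proof.
move=> mK /subsetP Xm; apply/ffunP => v; rewrite ffunE.
case: ifP => // /orP[] /Xm/unmatchedP; first by [].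
by rewrite mK.
Qed.

Lemma restrictU1 x X m : involutive m -> m x = x -> restrict (x |: X) m = restrict X m.
Proof.
move=> mK mx; apply/ffunP => v; rewrite !ffunE !in_setU1.
have -> : (m v == x) = (v == x) by rewrite -[in LHS]mx (inj_eq (inv_inj mK)).
by have [->|] := eqVneq v x; rewrite ?mx ?if_same.
Qed.

Lemma card_unmatched_restrict X Y m : involutive m ->
  (forall x, x \in X -> [|| x \in unmatched m, x \in Y | m x \in Y]) ->
  #|unmatched (restrict X m)| <= #|unmatched m| + 2 * #|Y|.
Proof.
move=> mK XY; have inY v : m v \in Y -> v \in m @: Y by move=> Ymv; rewrite -[v]mK imset_f.
have sub : unmatched (restrict X m) \subset unmatched m :|: (Y :|: m @: Y).
  apply/subsetP => v; rewrite !in_setU !inE ffunE; case: ifP => [vX _|_ ->//].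
  case/orP: vX => /XY; first by rewrite inE => /or3P[->|->|/inY->]; rewrite ?orbT.
  rewrite inE mK eq_sym; case/or3P => [->|/inY->|->]; rewrite ?orbT //.
have cardY : #|m @: Y| = #|Y| by apply/card_imset/inv_inj.
apply: leq_trans (subset_leq_card sub) (leq_trans (leq_card_setU _ _) _).
by rewrite leq_add2l mul2n -addnn -{2}cardY leq_card_setU.
Qed.

Lemma add_edgeC m u v : add_edge m u v = add_edge m v u.
Proof. by apply/ffunP => x; rewrite !ffunE; case: eqVneq => // ->; case: eqVneq => // ->. Qed.

Lemma card_unmatched_add_edge m u v : u != v -> m u = u -> m v = v ->
  #|unmatched (add_edge m u v)| + 2 = #|unmatched m|.
Proof.
move=> uv mu mv; have -> : unmatched (add_edge m u v) = unmatched m :\ u :\ v.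
  apply/setP => x; rewrite !inE ffunE.
  have [->|xu] := eqVneq x u; first by rewrite andbF eq_sym (negPf uv).
  by have [->|xv] := eqVneq x v; first by rewrite (negPf uv).
have := cardsD1 v (unmatched m :\ u); have := cardsD1 u (unmatched m).
by rewrite !inE mu mv !eqxx eq_sym uv /=; lia.
Qed.

Lemma avoids_add_edge X m u v : X \subset unmatched m -> u \notin X -> v \notin X ->
  X \subset unmatched (add_edge m u v).
Proof.
move=> /subsetP Xm uX vX; apply/subsetP => x xX; rewrite inE ffunE.
have xu : x != u by apply: contraNneq uX => <-.
have xv : x != v by apply: contraNneq vX => <-.
by rewrite (negPf xu) (negPf xv); have := Xm x xX; rewrite inE.
Qed.

Lemma avoids_switch X C m n : X \subset unmatched m -> X \subset unmatched n ->
  X \subset unmatched (switch C m n).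
Proof.
move=> /subsetP Xm /subsetP Xn; apply/subsetP => x xX; rewrite mem_unmatched_switch.
by case: ifP => _; [apply: Xm | apply: Xn].
Qed.

End Involutions.

Lemma card_unmatched_ord k (m : {ffun 'I_k -> 'I_k}) : involutive m ->
  #|unmatched m| + 2 * #|[pred v : 'I_k | v < m v]| = k.
Proof.
move=> mK; have := card_involution (A := setT) (@ord_inj k) mK (fun _ _ => in_setT _).
rewrite setIT cardsT card_ord => card_m; rewrite -[RHS]card_m; congr (_ + 2 * _).
by apply: eq_card => v; rewrite !inE.
Qed.

Lemma ltn_card_unmatched k (m m' : {ffun 'I_k -> 'I_k}) : involutive m -> involutive m' ->
  (#|unmatched m| < #|unmatched m'|) =
    (#|[pred v : 'I_k | v < m' v]| < #|[pred v : 'I_k | v < m v]|).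
Proof. by move=> /card_unmatched_ord + /card_unmatched_ord; lia. Qed.

(** * Alternating components *)

Section AlternatingComponent.
Variable V : finType.
Implicit Types (m n : {ffun V -> V}) (t v : V).

Definition alternating m n t : {set V} := [set v | fconnect (m \o n) t v].

Lemma mem_alternating m n t v :
  (v \in alternating m n t) = (v \in traject (m \o n) t #|V|).
Proof.
rewrite inE; apply/idP/trajectP => [tv|[i _ ->]]; last exact: fconnect_iter.
exists (findex (m \o n) t v); last by rewrite iter_findex.
exact: leq_trans (findex_max tv) (max_card _).
Qed.

Lemma alternating_refl m n t : t \in alternating m n t.
Proof. by rewrite inE connect0. Qed.

Lemma involutive_comp_inj m n : involutive m -> involutive n -> injective (m \o n).
Proof. by move=> mK nK; apply: inj_comp; apply: inv_inj. Qed.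

Lemma alternatingC m n t : involutive m -> involutive n ->
  alternating m n t = alternating n m t.
Proof.
move=> mK nK; apply/setP => v; rewrite !inE -(same_fconnect_finv (involutive_comp_inj mK nK)).
apply: eq_fconnect => x; apply: (involutive_comp_inj mK nK).
by rewrite f_finv /= ?nK ?mK //; apply: involutive_comp_inj.
Qed.

Lemma iter_alternating_mate m n t i : involutive m -> involutive n -> m t = t ->
  iter i (m \o n) (m (iter i (m \o n) t)) = t.
Proof.
move=> mK nK mt; elim: i => [|i IH] //.
by rewrite iterSr [iter i.+1 _ t]iterS /= mK nK.
Qed.

Lemma alternating_closed m n t v : involutive m -> involutive n -> m t = t \/ n t = t ->
  v \in alternating m n t -> (m v \in alternating m n t) && (n v \in alternating m n t).
Proof.
wlog mt : m n / m t = t => [wlog_mt mK nK|mK nK _].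
  case=> fixt; first by apply: wlog_mt => //; left.
  by rewrite alternatingC // andbC; apply: wlog_mt => //; left.
have mate_in x : x \in alternating m n t -> m x \in alternating m n t.
  rewrite !inE => /iter_findex tx.
  rewrite fconnect_sym; last exact: involutive_comp_inj.
  have := iter_alternating_mate (findex (m \o n) t x) mK nK mt.
  by rewrite tx => /esym t_def; rewrite [X in connect _ _ X]t_def fconnect_iter.
move=> tv; rewrite mate_in //= -[n v]mK mate_in //.
by move: tv; rewrite !inE => /connect_trans; apply; apply: fconnect1.
Qed.

Section Component.
Variables (m n : {ffun V -> V}) (t : V).
Hypotheses (mK : involutive m) (nK : involutive n) (mt : m t = t).
Let f := m \o n.
Let p := order f t.

Lemma iter_alternating_eq i j : i < p -> j < p -> (iter i f t == iter j f t) = (i == j).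
Proof.
move=> ip jp; apply/eqP/eqP => [eqij|-> //].
by rewrite -(findex_iter ip) eqij findex_iter.
Qed.

Lemma alternating_mate_l i : i <= p -> m (iter i f t) = iter (p - i) f t.
Proof.
have iter_inj : injective (iter i f).
  by elim: i => // i IH x y /(involutive_comp_inj mK nK)/IH.
move=> ip; apply: iter_inj; rewrite iter_alternating_mate // -iterD subnKC //.
by rewrite iter_order //; apply: involutive_comp_inj.
Qed.

Lemma alternating_mate_r i : i < p -> n (iter i f t) = iter (p - i.+1) f t.
Proof. by move=> ip; rewrite -alternating_mate_l // /f /= mK. Qed.

Lemma mem_unmatched_l i : i < p -> (iter i f t \in unmatched m) = (i == 0) || (i + i == p).
Proof.
move=> ip; rewrite inE alternating_mate_l; last exact: ltnW.
case: i ip => [|i] ip; first by rewrite subn0 iter_order ?eqxx //; apply: involutive_comp_inj.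
by rewrite iter_alternating_eq; lia.
Qed.

Lemma mem_unmatched_r i : i < p -> (iter i f t \in unmatched n) = (i + i + 1 == p).
Proof. by move=> ip; rewrite inE alternating_mate_r // iter_alternating_eq; lia. Qed.

Lemma alternating_iterP v : reflect (exists2 i, i < p & v = iter i f t) (v \in alternating m n t).
Proof. by rewrite inE fconnect_orbit; apply: trajectP. Qed.

Hypothesis nt : n t != t.

Lemma alternating_order_gt1 : 1 < p.
Proof.
have p_gt0 : 0 < p by apply: order_gt0.
have := mem_unmatched_r p_gt0; rewrite inE (negPf nt) => /esym p_neq1; lia.
Qed.

Lemma iter_alternating_half i : i < p -> (iter i f t == iter p./2 f t) = (i == p./2).
Proof. by have := alternating_order_gt1 => *; rewrite iter_alternating_eq //; lia. Qed.

Lemma iter_alternating_start i : i < p -> (iter i f t == t) = (i == 0).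
Proof.
by move=> ip; rewrite -[X in _ == X]/(iter 0 f t) iter_alternating_eq //; apply: order_gt0.
Qed.

Lemma alternating_half_neq : iter p./2 f t != t.
Proof. by have p_gt1 := alternating_order_gt1; rewrite iter_alternating_start; lia. Qed.

Lemma unmatched_alternating_l :
  unmatched m :&: alternating m n t = if odd p then [set t] else [set t; iter p./2 f t].
Proof.
apply/setP => v; rewrite in_setI; case: (boolP (v \in alternating m n t)) => [|vC].
  case/alternating_iterP => i ip ->; rewrite andbT mem_unmatched_l //.
  by case: ifP => p_odd; rewrite !inE iter_alternating_start ?iter_alternating_half //; lia.
rewrite andbF; apply/esym/(contraNF _ vC).
by case: ifP => _; rewrite !inE; [|case/orP]; move/eqP->; rewrite ?connect0 ?fconnect_iter.
Qed.

Lemma unmatched_alternating_r :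
  unmatched n :&: alternating m n t = if odd p then [set iter p./2 f t] else set0.
Proof.
apply/setP => v; rewrite in_setI; case: (boolP (v \in alternating m n t)) => [|vC].
  case/alternating_iterP => i ip ->; rewrite andbT mem_unmatched_r //.
  by case: ifP => p_odd; rewrite !inE ?iter_alternating_half //; lia.
rewrite andbF; apply/esym/(contraNF _ vC).
by case: ifP => _; rewrite !inE // => /eqP->; rewrite fconnect_iter.
Qed.

End Component.

(* The alternating component of [t] is a path starting at [t]; it ends either in a second
   vertex unmatched by [m], or in a vertex unmatched by [n]. *)
Variant alternating_spec m n t (C : {set V}) : Prop :=
| ExchangeSame z of z != t & unmatched m :&: C = [set t; z] & unmatched n :&: C = set0
    & #|unmatched (switch C m n)| = #|unmatched n| + 2
    & #|unmatched (switch C n m)| + 2 = #|unmatched m|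
| ExchangeOther z of z != t & unmatched m :&: C = [set t] & unmatched n :&: C = [set z]
    & #|unmatched (switch C m n)| = #|unmatched n|.

Lemma alternatingP m n t : involutive m -> involutive n -> m t = t -> n t != t ->
  alternating_spec m n t (alternating m n t).
Proof.
move=> mK nK mt nt; have zt := alternating_half_neq mK nK mt nt.
have := card_unmatched_switch (alternating m n t) m n.
have := card_unmatched_switch (alternating m n t) n m.
case: ifP (unmatched_alternating_l mK nK mt nt) (unmatched_alternating_r mK nK mt nt) => _ mC nC.
- by rewrite mC nC !cards1 => cnm cmn; apply: (ExchangeOther zt) => //; lia.
- rewrite mC nC cards2 cards0 eq_sym zt => cnm cmn.
  by apply: (ExchangeSame zt) => //; lia.
Qed.

End AlternatingComponent.

(** * Closed families of matchings *)

Section Matching.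
Variables (V : finType) (e : rel V).
Hypothesis e_sym : symmetric e.
Implicit Types (m n : {ffun V -> V}) (X C : {set V}).

Definition matching m : Prop := involutive m /\ forall v, m v != v -> e v (m v).

Lemma matching_id : matching [ffun v => v].
Proof. by split=> v; rewrite !ffunE ?eqxx. Qed.

Lemma restrict_matching X m : matching m -> matching (restrict X m).
Proof.
move=> [mK me]; split=> v; last by rewrite ffunE; case: ifP => _; [rewrite eqxx | apply: me].
case: (boolP ((v \in X) || (m v \in X))) => vX; first by rewrite !ffunE vX vX.
by rewrite !ffunE (negPf vX) mK orbC (negPf vX).
Qed.

Lemma switch_matching C m n : matching m -> matching n ->
  (forall x, x \in C -> (m x \in C) && (n x \in C)) -> matching (switch C m n).
Proof.
move=> [mK me] [nK ne] closedC; split=> v; last first.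
  by rewrite ffunE; case: ifP => _; [apply: me | apply: ne].
rewrite !ffunE; case: (boolP (v \in C)) => [/closedC/andP[-> _]|vC]; first exact: mK.
case: (boolP (n v \in C)) => [/closedC/andP[_]|_]; last exact: nK.
by rewrite nK (negPf vC).
Qed.

Lemma switch_alternating_matching m n t : matching m -> matching n -> m t = t \/ n t = t ->
  matching (switch (alternating m n t) m n).
Proof.
move=> mM nM fixt; apply: switch_matching => // x.
by case: mM nM => [mK _] [nK _]; apply: alternating_closed.
Qed.

Lemma add_edge_matching m u v : matching m -> e u v -> m u = u -> m v = v ->
  matching (add_edge m u v).
Proof.
move=> [mK me] euv mu mv; split=> x; last first.
  rewrite ffunE; have [->//|_] := eqVneq x u; have [->|_] := eqVneq x v; last exact: me.
  by rewrite e_sym.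
have m_eq y : m y = y -> (m x == y) = (x == y).
  by move=> my; rewrite -[in LHS]my (inj_eq (inv_inj mK)).
rewrite !ffunE; have [->|xu] := eqVneq x u; first by rewrite eqxx; case: eqP.
have [->|xv] := eqVneq x v; first by rewrite eqxx.
by rewrite !m_eq // (negPf xu) (negPf xv) mK.
Qed.

(* The bound 4 leaves room for two vertices of a component of the exposable vertices together
   with their mates in the barrier. *)
Definition absorbs (K : {set {ffun V -> V}}) n : Prop :=
  forall X, #|X| <= 4 -> exists2 m, m \in K &
    X \subset unmatched m /\ #|unmatched m| <= #|unmatched (restrict X n)|.

Record closed_family (K : {set {ffun V -> V}}) : Prop := ClosedFamily {
  family_matching : forall m, m \in K -> matching m;
  family_restrict : forall m, m \in K -> absorbs K m;
  family_add_edge : forall m u v, m \in K -> e u v -> m u = u -> m v = v ->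
    absorbs K (add_edge m u v);
  family_switch : forall m n t, m \in K -> n \in K -> m t = t \/ n t = t ->
    absorbs K (switch (alternating m n t) m n) }.

End Matching.

Section Gallai.
Variables (V : finType) (e : rel V).
Hypotheses (e_sym : symmetric e) (e_irr : irreflexive e).
Variable K : {set {ffun V -> V}}.
Hypothesis K_closed : closed_family e K.
Variable m0 : {ffun V -> V}.
Hypotheses (m0K : m0 \in K) (m0_min : forall m, m \in K -> #|unmatched m0| <= #|unmatched m|).
Implicit Types (m n : {ffun V -> V}) (X Y : {set V}).

Lemma family_involutive m : m \in K -> involutive m.
Proof. by case/(family_matching K_closed). Qed.

Lemma absorbed_avoiding n X Y : absorbs K n -> involutive n -> #|X| <= 4 ->
  (forall x, x \in X -> [|| x \in unmatched n, x \in Y | n x \in Y]) ->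
  exists2 m, m \in K & X \subset unmatched m /\ #|unmatched m| <= #|unmatched n| + 2 * #|Y|.
Proof.
move=> nA nK X4 XY; have [m mK [mX m_le]] := nA X X4.
by exists m => //; split=> //; apply: leq_trans m_le (card_unmatched_restrict nK XY).
Qed.

Definition deficiency_ge X d : Prop :=
  forall m, m \in K -> X \subset unmatched m -> d <= #|unmatched m|.

Lemma absorbed_deficiency X d n : deficiency_ge X d -> #|X| <= 4 ->
  absorbs K n -> involutive n -> X \subset unmatched n -> d <= #|unmatched n|.
Proof.
move=> Xd X4 nA nK Xn; have [m mK] := nA X X4.
by rewrite restrict_id // => -[/(Xd m mK)]; apply: leq_trans.
Qed.

Lemma add_edge_deficiency X d u v : deficiency_ge X d -> #|X| <= 4 -> e u v ->
  u \notin X -> v \notin X -> deficiency_ge (X :|: [set u; v]) (d + 2).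
Proof.
move=> Xd X4 euv uX vX n nK; rewrite !subUset !sub1set => /and3P[Xn nu nv].
have [/unmatchedP nu_fix /unmatchedP nv_fix] := (nu, nv).
have uv : u != v by apply: contraTneq euv => ->; rewrite e_irr.
rewrite -(card_unmatched_add_edge uv nu_fix nv_fix) leq_add2r.
have [addK _] := add_edge_matching e_sym (family_matching K_closed nK) euv nu_fix nv_fix.
apply: absorbed_deficiency Xd X4 _ addK _; first exact: (family_add_edge K_closed).
exact: avoids_add_edge.
Qed.

Lemma switch_deficiency X d m n t : deficiency_ge X d -> #|X| <= 4 ->
  m \in K -> n \in K -> m t = t \/ n t = t ->
  X \subset unmatched (switch (alternating m n t) m n) ->
  d <= #|unmatched (switch (alternating m n t) m n)|.
Proof.
move=> Xd X4 mK nK fixt; apply: absorbed_deficiency Xd X4 _ _.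
  exact: (family_switch K_closed).
have [mM nM] := (family_matching K_closed mK, family_matching K_closed nK).
by have [] := switch_alternating_matching mM nM fixt.
Qed.

Lemma switch_swap_deficiency X d m n t : deficiency_ge X d -> #|X| <= 4 ->
  m \in K -> n \in K -> m t = t \/ n t = t ->
  X \subset unmatched (switch (alternating m n t) n m) ->
  d <= #|unmatched (switch (alternating m n t) n m)|.
Proof.
move=> Xd X4 mK nK fixt; rewrite alternatingC; try exact: family_involutive.
by apply: switch_deficiency => //; case: fixt; [right | left].
Qed.

(* [exposable] and [barrier] are the sets D and A of the Gallai-Edmonds decomposition,
   relative to [K]. *)
Definition exposable : {set V} :=
  [set x | [exists m in K, (x \in unmatched m) && (#|unmatched m| <= #|unmatched m0|)]].

Definition barrier : {set V} :=
  [set a | (a \notin exposable) && [exists y in exposable, e a y]].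

Local Notation def0 := #|unmatched m0|.

Lemma exposableP x :
  reflect (exists2 m, m \in K & x \in unmatched m /\ #|unmatched m| <= def0) (x \in exposable).
Proof.
rewrite inE; apply: (iffP existsP) => [[m /and3P[mK mx m_le]]|[m mK [mx m_le]]]; exists m => //.
by rewrite mK mx.
Qed.

Lemma barrier_unexposable a : a \in barrier -> a \notin exposable.
Proof. by rewrite inE => /andP[]. Qed.

Lemma unexposable_deficiency a : a \notin exposable -> deficiency_ge [set a] (def0 + 2).
Proof.
move=> aD m mK; rewrite sub1set => ma; have: odd #|unmatched m| = odd def0.
  by rewrite !odd_unmatched //; apply: family_involutive.
have : def0 < #|unmatched m|.
  by rewrite ltnNge; apply: contra aD => m_le; apply/exposableP; exists m.
lia.
Qed.

Lemma barrier_neighbor_deficiency a b y : a \notin exposable -> b \notin exposable -> a != b ->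
  y \in exposable -> e a y -> deficiency_ge (b |: [set a; y]) (def0 + 4).
Proof.
move=> aD bD ab yD eay; rewrite -[4]/(2 + 2) addnA.
apply: add_edge_deficiency (unexposable_deficiency bD) _ eay _ _; rewrite ?cards1 ?in_set1 //.
by apply: contraTneq yD => ->.
Qed.

Lemma barrier_pair_deficiency a b : a \in barrier -> b \notin exposable -> a != b ->
  deficiency_ge [set a; b] (def0 + 4).
Proof.
move=> aA bD ab m mK; rewrite subUset !sub1set => /andP[am bm].
have aD := barrier_unexposable aA.
have [y yD eay] : exists2 y, y \in exposable & e a y.
  by move: aA; rewrite inE => /andP[_ /exists_inP].
have [M MK [yM M_le]] := exposableP _ yD.
have a_notM : M a != a.
  by apply: contra aD => aM; apply/exposableP; exists M; rewrite // inE.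
have ma := unmatchedP _ _ am; have fixa : m a = a \/ M a = a by left.
have [mI MI] := (family_involutive mK, family_involutive MK).
case: (alternatingP mI MI ma a_notM) => [z za mC MC card_mM card_Mm|z za mC MC card_mM].
- have aC : a \in alternating m M a by apply: alternating_refl.
  have [zb|zb] := eqVneq z b.
    suff : def0 + 4 <= #|unmatched (switch (alternating m M a) m M)|.
      by rewrite card_mM -[4]/(2 + 2) addnA leq_add2r leqNgt addn2 ltnS leqW.
    apply: switch_deficiency (barrier_neighbor_deficiency aD bD ab yD eay) _ mK MK fixa _.
      by rewrite (leq_trans (card_setU_pair _ _ _)) // cards1.
    have bC : b \in alternating m M a.
      have : b \in unmatched m :&: alternating m M a by rewrite mC -zb !inE eqxx orbT.
      by rewrite in_setI => /andP[].
    have yC : y \notin alternating m M a.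
      by have := in_set0 y; rewrite -MC in_setI yM /= => ->.
    by rewrite !subUset !sub1set !mem_unmatched_switch aC bC (negPf yC) am bm yM.
  have bC : b \notin alternating m M a.
    have : b \notin unmatched m :&: alternating m M a by rewrite mC !inE negb_or eq_sym ab eq_sym.
    by rewrite in_setI bm.
  rewrite -card_Mm -[4]/(2 + 2) addnA leq_add2r.
  apply: switch_swap_deficiency (unexposable_deficiency bD) _ mK MK fixa _.
    by rewrite cards1.
  by rewrite sub1set mem_unmatched_switch (negPf bC).
- suff : def0 + 2 <= #|unmatched (switch (alternating m M a) m M)|.
    by rewrite card_mM leqNgt addn2 ltnS leqW.
  apply: switch_deficiency (unexposable_deficiency aD) _ mK MK fixa _; first by rewrite cards1.
  by rewrite sub1set mem_unmatched_switch alternating_refl.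
Qed.

Lemma barrier_deficiency X : X \subset barrier -> #|X| <= 2 -> deficiency_ge X (def0 + 2 * #|X|).
Proof.
move=> XA; case card_X: #|X| => [|[|[|//]]] _.
- by move=> m mK _; rewrite addn0; apply: m0_min.
- have /cards1P[a def_X] : #|X| == 1 by rewrite card_X.
  rewrite def_X in XA *; rewrite sub1set in XA.
  exact: unexposable_deficiency (barrier_unexposable XA).
- have /cards2P[a [b [ab def_X]]] : #|X| == 2 by rewrite card_X.
  rewrite def_X in XA *; move: XA; rewrite subUset !sub1set => /andP[aA bA].
  exact: barrier_pair_deficiency aA (barrier_unexposable bA) ab.
Qed.

Lemma exposable_avoiding X t : #|X| <= 3 -> t \in exposable ->
  exists2 m, m \in K & t |: X \subset unmatched m /\ #|unmatched m| <= def0 + 2 * #|X|.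
Proof.
move=> X3 /exposableP[n nK [nt n_le]].
have [||m mK [mX m_le]] := @absorbed_avoiding n (t |: X) X (family_restrict K_closed nK)
  (family_involutive nK).
- by rewrite cardsU1; case: (_ \notin _); lia.
- by move=> x; rewrite in_setU1 => /orP[/eqP->|->]; rewrite ?nt ?orbT.
by exists m => //; split=> //; apply: leq_trans m_le _; rewrite leq_add2r.
Qed.

Definition exposable_adj : rel V := [rel x y | [&& x \in exposable, y \in exposable & e x y]].

Lemma exposable_connect_sym : connect_sym exposable_adj.
Proof. by apply: sym_connect_sym => x y; rewrite /exposable_adj /= e_sym andbCA. Qed.

Lemma exposable_connect x y : connect exposable_adj x y -> x \in exposable -> y \in exposable.
Proof.
case/connectP => p; elim: p x => [|z p IH] x /=; first by move=> _ ->.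
by case/andP => /and3P[_ zD _] /IH yD def_y _; apply: yD.
Qed.

(* Gallai's lemma in the graph without [X]: walking from [u] to [v] through exposable vertices,
   exchange with a matching that avoids the next vertex [t] until two unmatched vertices are
   adjacent. *)
Lemma exposable_step_deficiency X u t v : X \subset barrier -> #|X| <= 2 ->
  u != v -> t \in exposable ->
  deficiency_ge (X :|: [set u; t]) (def0 + 2 * #|X|).+1 ->
  deficiency_ge (X :|: [set t; v]) (def0 + 2 * #|X|).+1 ->
  deficiency_ge (X :|: [set u; v]) (def0 + 2 * #|X|).+1.
Proof.
move=> XA X2 uv tD utd tvd n nK Xuv.
have [Xn nu nv] : [/\ X \subset unmatched n, u \in unmatched n & v \in unmatched n].
  by apply/and3P; rewrite -!sub1set -!subUset.
have [nt|nt] := eqVneq (n t) t.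
  by apply: utd => //; rewrite !subUset !sub1set Xn nu inE nt eqxx.
have [|M MK [tXM M_le]] := exposable_avoiding (leq_trans X2 _) tD; first by [].
have [Mt XM] : M t = t /\ X \subset unmatched M.
  by move: tXM; rewrite subUset sub1set => /andP[/unmatchedP].
have [MI nI] := (family_involutive MK, family_involutive nK).
have fixt : M t = t \/ n t = t by left.
case: (alternatingP MI nI Mt nt) => [z zt MC nC card_Mn card_nM|z zt MC nC card_Mn].
  suff : def0 + 2 * #|X| <= #|unmatched (switch (alternating M n t) n M)|.
    rewrite -(leq_add2r 2) card_nM => /leq_trans/(_ M_le).
    by rewrite leqNgt addn2 ltnS leqnSn.
  apply: switch_swap_deficiency (barrier_deficiency XA X2) _ MK nK fixt _.
    exact: leq_trans X2 _.
  exact: avoids_switch.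
rewrite -card_Mn; have X4 a b : #|X :|: [set a; b]| <= 4.
  by rewrite (leq_trans (card_setU_pair _ _ _)) // -[4]/(2 + 2) leq_add2r.
have stays_unmatched w : w \in unmatched n -> w != z ->
    w \in unmatched (switch (alternating M n t) M n).
  move=> nw wz; rewrite mem_unmatched_switch ifN //.
  have : w \notin unmatched n :&: alternating M n t by rewrite nC inE.
  by rewrite in_setI nw.
have t_unmatched : t \in unmatched (switch (alternating M n t) M n).
  by rewrite mem_unmatched_switch alternating_refl inE Mt.
have [uz|uz] := eqVneq u z.
  apply: switch_deficiency tvd (X4 t v) MK nK fixt _.
  by rewrite !subUset !sub1set avoids_switch //= t_unmatched stays_unmatched // -uz eq_sym.
apply: switch_deficiency utd (X4 u t) MK nK fixt _.
by rewrite !subUset !sub1set avoids_switch //= t_unmatched stays_unmatched.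
Qed.

Lemma exposable_component_deficiency X u v : X \subset barrier -> #|X| <= 2 ->
  u \in exposable -> u != v -> connect exposable_adj u v ->
  deficiency_ge (X :|: [set u; v]) (def0 + 2 * #|X|).+1.
Proof.
move=> XA X2 uD uv /connectP[p]; have notin_X w : w \in exposable -> w \notin X.
  by move=> wD; apply: contraL wD => /(subsetP XA)/barrier_unexposable.
have adjacent a b : exposable_adj a b -> deficiency_ge (X :|: [set a; b]) (def0 + 2 * #|X|).+1.
  move=> /and3P[aD bD eab] m mK mX; rewrite -addn1.
  apply: leq_trans (_ : def0 + 2 * #|X| + 2 <= _); first by rewrite leq_add2l.
  apply: add_edge_deficiency (barrier_deficiency XA X2) _ eab _ _ m mK mX; rewrite ?notin_X //.
  exact: leq_trans X2 _.
elim: p u uD uv => [|t p IH] u uD uv /=; first by move=> _ def_v; rewrite def_v eqxx in uv.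
case/andP => ut t_p last_v; have [<-|tv] := eqVneq t v; first exact: adjacent.
have /and3P[_ tD _] := ut.
by apply: exposable_step_deficiency (adjacent _ _ ut) (IH t tD tv t_p last_v).
Qed.

Definition exits m : {set V} := [set x in exposable | (m x == x) || (m x \in barrier)].

Lemma exits_min_inj u v : u \in exits m0 -> v \in exits m0 -> connect exposable_adj u v -> u = v.
Proof.
rewrite ![_ \in exits m0]in_set => /andP[uD u_exit] /andP[vD v_exit] uv.
apply: contraTeq (leqnn def0) => neq_uv.
pose X := [set x in [set m0 u; m0 v] | x \in barrier].
have XA : X \subset barrier by apply/subsetP => x; rewrite inE => /andP[].
have X2 : #|X| <= 2.
  apply: leq_trans (subset_leq_card (_ : X \subset [set m0 u; m0 v])) _.
    by apply/subsetP => x; rewrite inE => /andP[].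
  by rewrite cards2; case: (_ != _).
have [||m mK [mX m_le]] := @absorbed_avoiding m0 (X :|: [set u; v]) X
  (family_restrict K_closed m0K) (family_involutive m0K).
- by rewrite (leq_trans (card_setU_pair _ _ _)) // -[4]/(2 + 2) leq_add2r.
- move=> x; rewrite in_setU in_set2 => /or3P[->|/eqP->|/eqP->]; rewrite ?orbT //.
    case/orP: u_exit => uE; first by rewrite inE uE.
    by rewrite [m0 u \in X]in_set in_set2 eqxx uE !orbT.
  case/orP: v_exit => vE; first by rewrite inE vE.
  by rewrite [m0 v \in X]in_set in_set2 eqxx vE !orbT.
by have := exposable_component_deficiency XA X2 uD neq_uv uv mK mX; rewrite ltnNge m_le.
Qed.

Lemma exposable_mate m y : matching e m -> y \in exposable -> y \notin exits m ->
  m y != y /\ exposable_adj y (m y).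
Proof.
move=> [_ me] yD; rewrite in_set yD negb_or => /andP[my myA]; split=> //.
have eym := me y my; rewrite /exposable_adj /= yD eym andbT.
apply: contraR myA => myD; rewrite in_set myD; apply/exists_inP; exists y => //.
by rewrite e_sym.
Qed.

(* Otherwise [m] would pair up the whole component of [x], and [m0] all of it but [x]. *)
Lemma exits_meet_component m x : matching e m -> x \in exits m0 ->
  exists2 y, y \in exits m & connect exposable_adj x y.
Proof.
move=> mM x_exit; have m0M := family_matching K_closed m0K.
have xD : x \in exposable by move: x_exit; rewrite in_set => /andP[].
have [/exists_inP//|/exists_inPn no_exit] := boolP [exists y in exits m, connect exposable_adj x y].
pose C := [set y | connect exposable_adj x y].
have mem_C y : (y \in C) = connect exposable_adj x y by rewrite inE.
have mate_C n y : matching e n -> y \in C -> y \notin exits n -> n y != y /\ n y \in C.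
  rewrite !mem_C => nM xy yE; have [ny y_ny] := exposable_mate nM (exposable_connect xy xD) yE.
  by split=> //; apply: connect_trans xy (connect1 y_ny).
have m_stable y : y \in C -> m y != y /\ m y \in C.
  move=> yC; apply: mate_C => //; apply: contraL yC => /no_exit.
  by rewrite mem_C.
have m0_stable y : y \in C :\ x -> m0 y != y /\ m0 y \in C :\ x.
  rewrite in_setD1 => /andP[yx yC]; have [|m0y m0yC] := mate_C m0 y m0M yC.
    by rewrite mem_C in yC; apply: contra yx => y_exit; rewrite (exits_min_inj x_exit y_exit yC).
  split=> //; rewrite in_setD1 m0yC andbT; apply: contraNneq yx => def_x.
  have m0x : m0 x = y by rewrite -def_x family_involutive.
  move: x_exit; rewrite in_set m0x => /andP[_ /orP[//|/barrier_unexposable]].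
  by rewrite (exposable_connect _ xD) //; rewrite -mem_C.
have even_C := even_matched_set (proj1 mM) (fun y yC => proj2 (m_stable y yC))
  (fun y yC => proj1 (m_stable y yC)).
have even_C1 := even_matched_set (proj1 m0M) (fun y yC => proj2 (m0_stable y yC))
  (fun y yC => proj1 (m0_stable y yC)).
have xC : x \in C by rewrite mem_C connect0.
by move: even_C; rewrite (cardsD1 x) xC /= negbK (negPf even_C1).
Qed.

Lemma family_unmatched_exposable x : x \in unmatched m0 -> x \in exposable.
Proof. by move=> m0x; apply/exposableP; exists m0. Qed.

Lemma barrier_mate_exposable a : a \in barrier -> m0 a \in exposable.
Proof.
move=> aA; apply/negPn/negP => m0aD; have m0I := family_involutive m0K.
have am0a : a != m0 a.
  apply: contra (barrier_unexposable aA) => m0a.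
  by apply: family_unmatched_exposable; rewrite inE eq_sym.
have [||m mK [mX m_le]] :=
  @absorbed_avoiding m0 [set a; m0 a] [set a] (family_restrict K_closed m0K) m0I.
- by rewrite cards2; case: (_ != _).
- by move=> x; rewrite in_set2 !in_set1 => /orP[]/eqP->; rewrite ?m0I eqxx ?orbT.
have := barrier_pair_deficiency aA m0aD am0a mK mX.
by move/leq_trans/(_ m_le); rewrite cards1 leq_add2l.
Qed.

Lemma card_exits_min : def0 + #|barrier| <= #|exits m0|.
Proof.
have m0I := family_involutive m0K; rewrite -(card_imset barrier (inv_inj m0I)) -cardsUI.
rewrite (_ : _ :&: _ = set0) ?cards0 ?addn0; last first.
  apply/setP => x; rewrite in_setI in_set0; apply/andP => -[/unmatchedP m0x /imsetP[a aA def_x]].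
  have := barrier_unexposable aA; rewrite (_ : a = m0 a) ?barrier_mate_exposable //.
  by rewrite -def_x -m0x def_x m0I.
apply: subset_leq_card; apply/subsetP => x.
rewrite in_setU [_ \in exits m0]in_set => /orP[m0x|/imsetP[a aA ->]].
  by rewrite family_unmatched_exposable //; move: m0x; rewrite inE => ->.
by rewrite barrier_mate_exposable //= m0I aA orbT.
Qed.

Lemma card_exits m : matching e m -> #|exits m| <= #|unmatched m| + #|barrier|.
Proof.
move=> [mI _]; rewrite -(card_imset barrier (inv_inj mI)).
apply: leq_trans (leq_card_setU _ _); apply: subset_leq_card; apply/subsetP => x.
rewrite [_ \in exits m]in_set in_setU => /andP[_ /orP[mx|mxA]]; first by rewrite inE mx.
by apply/orP; right; apply/imsetP; exists (m x).
Qed.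

Theorem closed_family_maximum m : matching e m -> def0 <= #|unmatched m|.
Proof.
move=> mM; rewrite -(leq_add2r #|barrier|).
apply: leq_trans card_exits_min (leq_trans _ (card_exits mM)).
have <- : #|root exposable_adj @: exits m0| = #|exits m0|.
  apply: card_in_imset => u v u_exit v_exit /eqP.
  by rewrite (root_connect exposable_connect_sym); apply: exits_min_inj.
apply: leq_trans (leq_imset_card (root exposable_adj) _); apply: subset_leq_card.
apply/subsetP => _ /imsetP[x x_exit ->]; have [y y_exit xy] := exits_meet_component mM x_exit.
by apply/imsetP; exists y => //; apply/eqP; rewrite (root_connect exposable_connect_sym).
Qed.

End Gallai.

(** * Walks and edge covers *)

Lemma last_map_filter d (f : nat -> nat) (P : pred nat) s :
  (exists2 i, i \in s & P i /\ last d [seq f i | i <- s & P i] = f i) \/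
  (forall i, i \in s -> ~~ P i) /\ last d [seq f i | i <- s & P i] = d.
Proof.
elim/last_ind: s => [|s i IH]; first by right.
rewrite filter_rcons; case: ifP => Pi.
  by left; exists i; rewrite ?mem_rcons ?mem_head // map_rcons last_rcons.
case: IH => [[j js Pj]|[no_P ->]]; [left; exists j | right; split] => //.
  by rewrite mem_rcons inE js orbT.
by move=> j; rewrite mem_rcons inE => /predU1P[->|/no_P//]; rewrite Pi.
Qed.

Section Walk.
Variables (n : nat) (R : nat -> 'I_n.+1).
Implicit Types (m : {ffun 'I_n.+1 -> 'I_n.+1}) (g p : nat) (u v w : 'I_n.+1).

Definition joins g u v : bool :=
  (R g == u) && (R g.+1 == v) || (R g == v) && (R g.+1 == u).

(* [ord0] is the null vertex: the walk visits it where it is interrupted. *)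
Definition walk_edge : rel 'I_n.+1 := fun u v =>
  [&& u != v, u != ord0, v != ord0 & [exists g : 'I_n.+1, joins g u v]].

Lemma joinsC g u v : joins g u v = joins g v u.
Proof. by rewrite /joins orbC. Qed.

Lemma walk_edge_sym : symmetric walk_edge.
Proof.
move=> u v; rewrite /walk_edge eq_sym (andbCA (u != _)).
by do 3!congr (_ && _); apply: eq_existsb => g; apply: joinsC.
Qed.

Lemma walk_edge_irr : irreflexive walk_edge.
Proof. by move=> u; rewrite /walk_edge eqxx. Qed.

Lemma null_unmatched m : matching walk_edge m -> m ord0 = ord0.
Proof.
move=> [_ me]; apply/eqP/negPn/negP => /me.
by rewrite /walk_edge eqxx andbF.
Qed.

(* Every vertex is the name of a position at which it is visited. *)
Definition walk_vertex v : bool := (v != ord0) && (R v == v).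

Definition covers p v : bool := (R p == v) || (R p.-1 == v).

Definition selected m v : bool := walk_vertex v && (v <= m v).

Definition chosen u v : nat := last (nat_of_ord u) [seq g.+1 | g <- iota 0 n.+1 & joins g u v].

Definition positions m : seq nat :=
  [seq p <- iota 0 n.+1 | [exists v, selected m v && (chosen v (m v) == p)]].

Hypothesis R_idem : forall p, R (R p) = R p.
Hypothesis R_end : forall p, n <= p -> R p = ord0.

Lemma walk_vertexP v : reflect (v != ord0 /\ exists p, R p = v) (walk_vertex v).
Proof.
apply: (iffP andP) => [[v0 /eqP vR]|[v0 [p def_v]]]; split=> //; first by exists v.
by rewrite -def_v R_idem.
Qed.

Lemma walk_edge_vertex u v : walk_edge u v -> walk_vertex u.
Proof.
case/and4P=> _ u0 _ /existsP[g joins_uv]; apply/walk_vertexP; split=> //.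
by case/orP: joins_uv => /andP[/eqP Rg /eqP Rg1]; [exists g | exists g.+1].
Qed.

Lemma card_selected m : matching walk_edge m ->
  #|selected m| + #|[pred v : 'I_n.+1 | v < m v]| = #|walk_vertex|.
Proof.
move=> [mK me]; rewrite -(cardsE [pred v : 'I_n.+1 | v < m v]).
rewrite -(card_preimset _ (inv_inj mK)) -(cardID [pred v : 'I_n.+1 | v <= m v] walk_vertex).
congr (_ + _); apply: eq_card => v; rewrite !inE // mK -ltnNge.
apply/idP/andP => [lt_mv|[]//]; split=> //.
by apply: (@walk_edge_vertex _ (m v)); apply: me; rewrite neq_ltn lt_mv.
Qed.

Lemma card_selected_le m m' : matching walk_edge m -> matching walk_edge m' ->
  #|unmatched m| <= #|unmatched m'| -> #|selected m| <= #|selected m'|.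
Proof.
move=> mM m'M le_mm'; rewrite -(leq_add2r #|[pred v : 'I_n.+1 | v < m v]|) card_selected //.
rewrite -(card_selected m'M) leq_add2l leqNgt.
by rewrite -(ltn_card_unmatched (proj1 m'M) (proj1 mM)) -leqNgt.
Qed.

Lemma covers_unique p u v w : covers p u -> covers p v -> covers p w ->
  u != v -> u != w -> v = w.
Proof.
by rewrite /covers => /orP[]/eqP<- /orP[]/eqP<- /orP[]/eqP<-; rewrite ?eqxx.
Qed.

Lemma covers_joins p u v : u != v -> covers p u -> covers p v -> joins p.-1 u v.
Proof.
rewrite /covers /joins => uv pu pv; move: pu pv uv; case: p => [|p] /=; rewrite ?orbb.
  by move=> /eqP<- /eqP<-; rewrite eqxx.
by move=> /orP[]/eqP<- /orP[]/eqP<-; rewrite !eqxx ?orbT.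
Qed.

Lemma joins_lt g u v : u != ord0 -> v != ord0 -> joins g u v -> g.+1 < n.
Proof.
move=> u0 v0 joins_uv; rewrite ltnNge; apply/negP => /R_end Rg1.
by case/orP: joins_uv => /andP[_]; rewrite Rg1 eq_sym ?(negPf u0) ?(negPf v0).
Qed.

Lemma covers_edge p u v : walk_vertex u -> walk_vertex v -> u != v ->
  covers p u -> covers p v -> walk_edge u v.
Proof.
move=> /andP[u0 _] /andP[v0 _] uv pu pv; rewrite /walk_edge uv u0 v0 /=.
have joins_uv := covers_joins uv pu pv; apply/existsP.
have p_lt : p.-1 < n.+1 by have := joins_lt u0 v0 joins_uv; lia.
by exists (Ordinal p_lt).
Qed.

Section CoverMatching.
Variable G : seq nat.
Hypothesis G_covers : forall v, walk_vertex v -> exists2 p, p \in G & covers p v.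

Definition cover_position v : nat := head 0 [seq p <- G | covers p v].

Definition same_position : rel 'I_n.+1 := fun v w =>
  [&& walk_vertex v, walk_vertex w, v != w & cover_position v == cover_position w].

Definition cover_mate : {ffun 'I_n.+1 -> 'I_n.+1} :=
  [ffun v => odflt v [pick w | same_position v w]].

Lemma cover_positionP v : walk_vertex v ->
  cover_position v \in G /\ covers (cover_position v) v.
Proof.
move=> /G_covers[p pG pv].
suff : cover_position v \in [seq p <- G | covers p v] by rewrite mem_filter => /andP[].
rewrite /cover_position; case def_s: [seq p <- G | _] => [|q s] /=; last exact: mem_head.
by have := in_nil p; rewrite -def_s mem_filter pv pG.
Qed.

Lemma same_position_sym : symmetric same_position.
Proof. by move=> v w; rewrite /same_position andbCA (eq_sym v) (eq_sym (cover_position v)). Qed.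

Lemma same_position_covers v w : same_position v w ->
  covers (cover_position v) v /\ covers (cover_position v) w.
Proof.
case/and4P=> /cover_positionP[_ pv] /cover_positionP[_ pw] _ /eqP eq_pos.
by split=> //; rewrite eq_pos.
Qed.

Lemma cover_mate_eq v w : same_position v w -> cover_mate v = w.
Proof.
move=> vw; rewrite ffunE; case: pickP => [w' vw'|/(_ w)]; last by rewrite vw.
have [[pv pw] [_ pw']] := (same_position_covers vw, same_position_covers vw').
by apply: (covers_unique pv) => //; [case/and4P: vw' | case/and4P: vw].
Qed.

Lemma cover_mateP v : cover_mate v = v \/ same_position v (cover_mate v).
Proof. by rewrite ffunE; case: pickP => [w|_]; [right | left]. Qed.

Lemma cover_mate_matching : matching walk_edge cover_mate.
Proof.
split=> v.
  by have [fix_v|] := cover_mateP v; [rewrite !fix_v | rewrite same_position_sym => /cover_mate_eq].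
have [->|v_mate _] := cover_mateP v; first by rewrite eqxx.
have [pv pw] := same_position_covers v_mate.
by case/and4P: v_mate => v_vx w_vx vw _; apply: covers_edge pv pw.
Qed.

Lemma card_selected_cover_mate : #|selected cover_mate| <= size G.
Proof.
rewrite cardE -(size_map cover_position); apply: uniq_leq_size; last first.
  by move=> _ /mapP[v + ->]; rewrite mem_enum => /andP[/cover_positionP[]].
rewrite map_inj_in_uniq ?enum_uniq // => u v; rewrite !mem_enum.
move=> /andP[u_vx u_le] /andP[v_vx v_le] eq_pos; apply: contraTeq v_le => uv.
have uv_same : same_position u v by rewrite /same_position u_vx v_vx uv eq_pos eqxx.
rewrite (cover_mate_eq uv_same) in u_le.
by rewrite same_position_sym in uv_same; rewrite (cover_mate_eq uv_same) -ltnNge ltn_neqAle uv.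
Qed.

End CoverMatching.

Lemma chosen_spec m v : matching walk_edge m -> selected m v ->
  [/\ 0 < chosen v (m v) <= n, covers (chosen v (m v)) v & covers (chosen v (m v)) (m v)].
Proof.
move=> mM /andP[v_vx _]; have [v0 vR] := andP v_vx.
have mv0 : m v != ord0 by rewrite -(null_unmatched mM) (inj_eq (inv_inj (proj1 mM))).
rewrite /chosen; set last_g := last _ _.
have [] := last_map_filter v succn (fun g => joins g v (m v)) (iota 0 n.+1); rewrite -/last_g.
  move=> [g _ [joins_g ->]]; have := joins_lt v0 mv0 joins_g.
  by case/orP: joins_g => /andP[/eqP Rg /eqP Rg1] lt_g; rewrite /covers /= Rg Rg1 !eqxx ?orbT ltnW.
move=> [no_joins ->]; have mv : m v = v; last by rewrite mv /covers vR lt0n v0 -ltnS ltn_ord.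
apply/eqP/negPn/negP => /(proj2 mM)/and4P[_ _ _ /existsP[g joins_g]].
by have := no_joins g; rewrite mem_iota ltn_ord joins_g => /(_ isT).
Qed.

Lemma positions_uniq m : uniq (positions m).
Proof. by rewrite filter_uniq ?iota_uniq. Qed.

Lemma mem_positions m p : matching walk_edge m ->
  reflect (exists2 v, selected m v & p = chosen v (m v)) (p \in positions m).
Proof.
move=> mM; rewrite mem_filter.
apply: (iffP andP) => [[/existsP[v /andP[sel /eqP def_p]]]|[v sel ->]].
  by exists v.
split; first by apply/existsP; exists v; rewrite sel eqxx.
by have [/andP[_ le_n] _ _] := chosen_spec mM sel; rewrite mem_iota.
Qed.

Lemma size_positions m : matching walk_edge m -> size (positions m) <= #|selected m|.
Proof.
move=> mM; rewrite cardE -(size_map (fun v => chosen v (m v))).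
apply: uniq_leq_size (positions_uniq m) _ => p /(mem_positions _ mM)[v sel ->].
by apply/mapP; exists v; rewrite // mem_enum.
Qed.

Lemma positions_bounds m p : matching walk_edge m -> p \in positions m -> 0 < p <= n.
Proof. by move=> mM /(mem_positions _ mM)[v sel ->]; case: (chosen_spec mM sel). Qed.

Lemma positions_cover m v : matching walk_edge m -> walk_vertex v ->
  exists2 p, p \in positions m & covers p v.
Proof.
move=> mM v_vx; have [mK me] := mM.
have in_positions w : selected m w -> chosen w (m w) \in positions m.
  by move=> sel; apply/mem_positions => //; exists w.
have [le_v|lt_mv] := leqP v (m v).
  have sel : selected m v by rewrite /selected v_vx.
  by exists (chosen v (m v)); [apply: in_positions | case: (chosen_spec mM sel)].
have sel : selected m (m v).
  rewrite /selected mK (ltnW lt_mv) andbT; apply: (@walk_edge_vertex _ v).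
  by rewrite walk_edge_sym me // neq_ltn lt_mv.
exists (chosen (m v) v); first by have := in_positions _ sel; rewrite mK.
by have := chosen_spec mM sel; rewrite mK => -[].
Qed.

End Walk.

(** * Attractors as edge covers *)

Section BigramWalk.
Variables (T : eqType) (S : seq T).
Local Notation n := (size S).
Implicit Types (p q : nat) (G : {fset nat}).

Definition occurs p q : bool :=
  [&& 0 < q, q < n & substring S q q.+1 == substring S p p.+1].

(* [bigram p] is the last position at which the bigram at position [p] occurs; it is null when
   there is no bigram at [p]. *)
Definition bigram p : 'I_n.+1 := inord (last 0 [seq q <- iota 0 n.+1 | occurs p q]).

Lemma size_substring (i j : nat) : 0 < i -> j <= n -> size (substring S i j) = j.+1 - i.
Proof. by move=> i0 jn; rewrite size_drop size_takel //; lia. Qed.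

Lemma size_bigram p : (size (substring S p p.+1) == 2) = (0 < p < n).
Proof. by rewrite size_drop size_take_min; lia. Qed.

Lemma occurs_valid p q : occurs p q -> 0 < p < n.
Proof. by case/and3P=> q0 qn /eqP eq_qp; rewrite -size_bigram -eq_qp size_bigram q0. Qed.

Lemma bigramE p : bigram p = last 0 [seq q <- iota 0 n.+1 | occurs p q] :> nat.
Proof.
rewrite inordK // -[X in last _ X]map_id.
have [[q + [_ ->]]|[_ ->//]] := last_map_filter 0 id (occurs p) (iota 0 n.+1).
by rewrite mem_iota.
Qed.

Lemma bigram_occurs p : 0 < p < n -> occurs p (bigram p).
Proof.
move=> pn; rewrite bigramE -[X in last _ X]map_id.
case: (last_map_filter 0 id (occurs p) (iota 0 n.+1)) => [[q _ [occ_q ->]]//|[no_occ _]].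
have := no_occ p; rewrite mem_iota /occurs eqxx andbT pn.
by case/andP: pn => _ /ltnW pn; rewrite ltnS pn => /(_ isT).
Qed.

Lemma bigram_null p : ~~ (0 < p < n) -> bigram p = ord0.
Proof.
move=> p_invalid; apply: val_inj.
rewrite /= bigramE (eq_filter (a2 := pred0)) ?filter_pred0 // => q.
by apply: contraNF p_invalid => /occurs_valid.
Qed.

Lemma bigram_valid p : bigram p != ord0 -> 0 < p < n.
Proof. by apply: contraR => /bigram_null->. Qed.

Lemma eq_bigram p q : substring S p p.+1 = substring S q q.+1 -> bigram p = bigram q.
Proof.
by move=> eq_pq; congr inord; congr last; apply: eq_filter => r; rewrite /occurs eq_pq.
Qed.

Lemma bigram_substring p : 0 < p < n ->
  substring S (bigram p) (bigram p).+1 = substring S p p.+1.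
Proof. by move/bigram_occurs/and3P=> [_ _ /eqP]. Qed.

Lemma bigram_idem p : bigram (bigram p) = bigram p.
Proof.
have [p_valid|p_invalid] := boolP (0 < p < n); first exact/eq_bigram/bigram_substring.
by rewrite (bigram_null p_invalid) bigram_null.
Qed.

Lemma bigram_end p : n <= p -> bigram p = ord0.
Proof. by move=> np; apply: bigram_null; rewrite [p < n]ltnNge np andbF. Qed.

Lemma sharp_attractor2P G : sharp_attractor 2 S G <->
  (forall p, p \in G -> 0 < p <= n) /\
  (forall v, walk_vertex bigram v -> exists2 p, p \in G & covers bigram p v).
Proof.
split=> -[G_range G_covers]; split=> //.
- move=> v v_vx; have /andP[v0 /eqP vR] := v_vx.
  have /andP[v_gt0 v_lt] : 0 < v < n by rewrite bigram_valid ?vR.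
  have [|i [j [i0 ij jn eq_ij [p pG /andP[ip pj]]]]] := G_covers v v.+1 v_gt0 (leqnSn v) v_lt.
    by rewrite subSnn.
  have j_def : j = i.+1.
    by have := congr1 size eq_ij; rewrite !size_substring //; lia.
  rewrite j_def in eq_ij pj; have iv : bigram i = v by rewrite (eq_bigram eq_ij).
  exists p; rewrite // /covers -iv.
  have [->|->] : p = i \/ p = i.+1 by lia.
    by rewrite eqxx.
  by rewrite eqxx orbT.
- move=> i j i0 ij jn ji; have {ij ji} j_def : j = i.+1 by lia.
  rewrite {j}j_def in jn *; have i_valid : 0 < i < n by rewrite i0.
  have v_vx : walk_vertex bigram (bigram i).
    rewrite /walk_vertex bigram_idem eqxx andbT; apply: contraTneq (bigram_occurs i_valid) => ->.
    by rewrite /occurs.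
  have [p pG p_covers] := G_covers _ v_vx.
  have [q eq_q pq] : exists2 q, bigram q = bigram i & q <= p <= q.+1.
    by case/orP: p_covers => /eqP eq_p; [exists p | exists p.-1] => //; lia.
  have /andP[q0 qn] : 0 < q < n by rewrite bigram_valid // eq_q; case/andP: v_vx.
  exists q, q.+1; split=> //; last by exists p.
  by rewrite -bigram_substring ?q0 // eq_q bigram_substring.
Qed.

Lemma positions_minimum_attractor m : matching (walk_edge bigram) m ->
  (forall m', matching (walk_edge bigram) m' -> #|unmatched m| <= #|unmatched m'|) ->
  minimum_sharp_attractor 2 S [fset p in positions bigram m]%fset.
Proof.
move=> mM m_max; split=> [|G /sharp_attractor2P[_ G_covers]].
  apply/sharp_attractor2P; split=> [p|v /(positions_cover bigram_idem bigram_end mM)[p pm pv]].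
    by rewrite in_fset => /(positions_bounds bigram_end mM).
  by exists p; rewrite ?in_fset.
rewrite card_fseq (leq_trans (size_undup _)) // (leq_trans (size_positions bigram_end mM)) //.
apply: leq_trans (card_selected_cover_mate G_covers).
have mateM := cover_mate_matching bigram_end G_covers.
by apply: card_selected_le (m_max _ mateM) => //; apply: bigram_idem.
Qed.

Lemma bigram_nth x0 p : 0 < p < n -> substring S p p.+1 = [:: nth x0 S p.-1; nth x0 S p].
Proof.
case/andP=> p0 pn; have size_p : size (take p.+1 S) = p.+1 by rewrite size_takel.
rewrite /substring (drop_nth x0) ?size_p ?nth_take ?prednK //.
by rewrite (drop_nth x0) ?size_p // nth_take // drop_oversize ?size_p.
Qed.

Lemma occurs_nth x0 p q : occurs p q =
  [&& 0 < q < n, 0 < p < n, nth x0 S q.-1 == nth x0 S p.-1 & nth x0 S q == nth x0 S p].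
Proof.
apply/idP/idP => [occ_q|/and4P[q_valid p_valid eq1 eq2]].
  have p_valid := occurs_valid occ_q; have /and3P[q0 qn /eqP] := occ_q.
  rewrite q0 qn p_valid !(bigram_nth x0) // => [[-> ->]|]; last by rewrite q0.
  by rewrite !eqxx.
by rewrite /occurs !(bigram_nth x0) // (eqP eq1) (eqP eq2) eqxx andbT.
Qed.

End BigramWalk.

(** * A loop language and its compiler *)

Inductive expr : Type :=
| Const of nat
| Len
| Input of expr
| Get of nat & expr
| Plus of expr & expr
| Minus of expr & expr.

Inductive cmd : Type :=
| Skip
| Store of nat & expr & expr
| Seq of cmd & cmd
| If of expr & cmd & cmd
| Rep of cmd
| Write of expr.

Notation "c1 ;; c2" := (Seq c1 c2) (at level 80, right associativity).

Record state : Type := State { arr : nat -> nat -> nat; out : seq nat }.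

Definition set_arr (s : state) (a i v : nat) : state :=
  State (fun a' i' => if (a' == a) && (i' == i) then v else arr s a' i') (out s).

Section Semantics.
Variable inp : seq nat.

Fixpoint eval (e : expr) (s : state) : nat :=
  match e with
  | Const c => c
  | Len => size inp
  | Input e => nth 0 inp (eval e s)
  | Get a e => arr s a (eval e s)
  | Plus e1 e2 => eval e1 s + eval e2 s
  | Minus e1 e2 => eval e1 s - eval e2 s
  end.

Fixpoint sem (c : cmd) (s : state) : state :=
  match c with
  | Skip => s
  | Store a e1 e2 => set_arr s a (eval e1 s) (eval e2 s)
  | c1 ;; c2 => sem c2 (sem c1 s)
  | If e c1 c2 => if 0 < eval e s then sem c1 s else sem c2 s
  | Rep c => iter (size inp).+1 (sem c) s
  | Write e => State (arr s) (rcons (out s) (eval e s))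
  end.

End Semantics.

Section Compiler.

(* Register [stride * j] is the [j]-th temporary, and register [stride * i + a.+1] holds
   item [i] of array [a]; hence array names must satisfy [a.+1 < stride]. *)
Variable stride : nat.

Definition temp (j : nat) : nat := stride * j.
Definition cell (a i : nat) : nat := stride * i + a.+1.

Definition address (a d d' : nat) : program :=
  Iconst (temp d') a.+1 :: nseq stride (Iadd (temp d') (temp d') (temp d)).
Local Arguments address : simpl never.

Fixpoint compile_expr (e : expr) (d : nat) : program :=
  match e with
  | Const c => [:: Iconst (temp d) c]
  | Len => [:: Ilen (temp d)]
  | Input e => compile_expr e d ++ [:: Iread (temp d) (temp d)]
  | Get a e => (compile_expr e d ++ address a d d.+1) ++ [:: Iload (temp d) (temp d.+1)]
  | Plus e1 e2 =>
      compile_expr e1 d ++ compile_expr e2 d.+1 ++ [:: Iadd (temp d) (temp d) (temp d.+1)]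
  | Minus e1 e2 =>
      compile_expr e1 d ++ compile_expr e2 d.+1 ++ [:: Isub (temp d) (temp d) (temp d.+1)]
  end.

Fixpoint expr_ok (e : expr) : bool :=
  match e with
  | Const _ | Len => true
  | Input e => expr_ok e
  | Get a e => (a.+1 < stride) && expr_ok e
  | Plus e1 e2 | Minus e1 e2 => expr_ok e1 && expr_ok e2
  end.

Fixpoint cmd_ok (c : cmd) : bool :=
  match c with
  | Skip => true
  | Store a e1 e2 => [&& a.+1 < stride, expr_ok e1 & expr_ok e2]
  | c1 ;; c2 => cmd_ok c1 && cmd_ok c2
  | If e c1 c2 => [&& expr_ok e, cmd_ok c1 & cmd_ok c2]
  | Rep c => cmd_ok c
  | Write e => expr_ok e
  end.

Definition countdown (d l : nat) : program :=
  [:: Iconst (temp d.+1) 1; Isub (temp d) (temp d) (temp d.+1);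
      Iconst (temp d.+1) 0; Ijumplt (temp d.+1) (temp d) l].

(* Jump targets are absolute: [compile c d l] is meant to be placed at [l]. *)
Fixpoint compile (c : cmd) (d l : nat) : program :=
  match c with
  | Skip => [::]
  | Store a e1 e2 =>
      (compile_expr e1 d ++ compile_expr e2 d.+1 ++ address a d d.+2) ++
      [:: Istore (temp d.+2) (temp d.+1)]
  | c1 ;; c2 => let p1 := compile c1 d l in p1 ++ compile c2 d (l + size p1)
  | If e c1 c2 =>
      let pe := compile_expr e d in
      let p2 := compile c2 d (l + size pe).+2 in
      let l1 := ((l + size pe).+2 + size p2).+1 in
      let p1 := compile c1 d l1 in
      pe ++ [:: Iconst (temp d.+1) 0; Ijumplt (temp d.+1) (temp d) l1] ++
      p2 ++ [:: Ijump (l1 + size p1)] ++ p1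
  | Rep c =>
      [:: Ilen (temp d); Iconst (temp d.+1) 1; Iadd (temp d) (temp d) (temp d.+1)] ++
      compile c d.+1 (l + 3) ++ countdown d (l + 3)
  | Write e => compile_expr e d ++ [:: Iwrite (temp d)]
  end.

(* [N] stands for the number of repetitions of a loop. *)
Fixpoint time (c : cmd) (N : nat) : nat :=
  match c with
  | Skip => 0
  | Store _ e1 e2 => size (compile_expr e1 0) + (size (compile_expr e2 0) + (stride.+1 + 1))
  | Write e => size (compile_expr e 0) + 1
  | c1 ;; c2 => time c1 N + time c2 N
  | If e c1 c2 => size (compile_expr e 0) + (2 + (time c1 N + time c2 N + 1))
  | Rep c => 3 + N * (time c N + 4)
  end.

Lemma size_address a d d' : size (address a d d') = stride.+1.
Proof. by rewrite /address /= size_nseq. Qed.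

Lemma size_compile_expr e d : size (compile_expr e d) = size (compile_expr e 0).
Proof.
elim: e d => //= [e IH|a e IH|e1 IH1 e2 IH2|e1 IH1 e2 IH2] d.
- by rewrite !size_cat IH.
- by rewrite !size_cat !size_address IH.
- by rewrite !size_cat IH1 (IH2 d.+1) (IH2 1).
- by rewrite !size_cat IH1 (IH2 d.+1) (IH2 1).
Qed.

Variable inp : seq nat.

Definition represents (m : nat -> nat) (s : state) : Prop :=
  forall a i, a.+1 < stride -> m (cell a i) = arr s a i.

Definition agree_below (d : nat) (m m' : nat -> nat) : Prop :=
  forall j, j < d -> m' (temp j) = m (temp j).

Definition placed (p : program) (l : nat) (q : program) : Prop :=
  forall i, i < size q -> nth Ihalt p (l + i) = nth Ihalt q i.

Lemma placed_cat p l q1 q2 :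
  placed p l (q1 ++ q2) <-> placed p l q1 /\ placed p (l + size q1) q2.
Proof.
split=> [pq|[pq1 pq2] i]; last first.
  rewrite size_cat nth_cat => lti; case: ltnP => hi; first exact: pq1.
  by rewrite -pq2; [congr nth; lia | lia].
split=> i lti.
  by have := pq i; rewrite size_cat nth_cat lti; apply; lia.
have := pq (size q1 + i); rewrite size_cat nth_cat ltn_add2l addnA => /(_ lti) ->.
by rewrite [_ < size q1]ltnNge leq_addr /= addKn.
Qed.

Lemma placed_cons p l x q :
  placed p l (x :: q) <-> nth Ihalt p l = x /\ placed p l.+1 q.
Proof.
rewrite -cat1s placed_cat /= addn1; split=> -[px pq]; split=> //.
  by have := px 0 isT; rewrite addn0.
by case=> // _; rewrite addn0.
Qed.

Hypothesis stride_gt0 : 0 < stride.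

Lemma temp_eq i j : (temp i == temp j) = (i == j).
Proof. by rewrite eqn_pmul2l. Qed.

Lemma cell_temp a i j : a.+1 < stride -> (cell a i == temp j) = false.
Proof.
move=> a_lt; apply/eqP => /(congr1 (modn^~ stride)) /=.
by rewrite /cell /temp mulnC modnMDl modn_small // modnMr.
Qed.

Lemma cell_eq a i b j : a.+1 < stride -> b.+1 < stride ->
  (cell a i == cell b j) = (a == b) && (i == j).
Proof.
move=> a_lt b_lt; apply/eqP/andP => [eq_cell|[/eqP-> /eqP->]] //.
have eqab : a.+1 = b.+1.
  have /(congr1 (modn^~ stride)) := eq_cell.
  by rewrite /cell ![stride * _]mulnC !modnMDl !modn_small.
move: eq_cell; rewrite /cell eqab => /addIn/eqP; rewrite eqn_pmul2l // => /eqP->.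
by case: eqab => ->.
Qed.

Lemma represents_temp m s j v : represents m s -> represents (upd m (temp j) v) s.
Proof. by move=> ms a i a_lt; rewrite /upd cell_temp // ms. Qed.

Lemma represents_cell m s a i v : a.+1 < stride -> represents m s ->
  represents (upd m (cell a i) v) (set_arr s a i v).
Proof. by move=> a_lt ms b j b_lt; rewrite /upd cell_eq //= ms. Qed.

Lemma upd_temp m i j v : upd m (temp j) v (temp i) = if i == j then v else m (temp i).
Proof. by rewrite /upd temp_eq. Qed.

Lemma agree_below_upd d m m' j v : d <= j ->
  agree_below d m m' -> agree_below d m (upd m' (temp j) v).
Proof.
move=> dj mm' i id; rewrite upd_temp ifN ?mm' //.
by apply: contraTneq id => ->; rewrite -leqNgt.
Qed.

Definition exec (p : program) (t : nat) (c : config) : config := iter t (step p inp) c.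
Local Arguments exec : simpl never.

Lemma execS p t c : exec p t.+1 c = exec p t (step p inp c).
Proof. by rewrite /exec iterSr. Qed.

(* Within [T] steps, [p] goes from [c] to instruction [l'] with the machine representing [s'],
   without changing the first [d] temporaries. *)
Definition reaches (p : program) (T d : nat) (c : config) (l' : nat) (s' : state)
    (Q : (nat -> nat) -> Prop) : Prop :=
  exists t m', [/\ t <= T, exec p t c = Config l' m' (out s'), represents m' s',
    agree_below d (regs c) m' & Q m'].

Lemma reaches_bind p T1 T2 d d1 d2 c l1 s1 (Q1 : (nat -> nat) -> Prop) l2 s2 Q2 :
  d <= d1 -> d <= d2 -> reaches p T1 d1 c l1 s1 Q1 ->
  (forall m1, represents m1 s1 -> agree_below d1 (regs c) m1 -> Q1 m1 ->
    reaches p T2 d2 (Config l1 m1 (out s1)) l2 s2 Q2) ->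
  reaches p (T1 + T2) d c l2 s2 Q2.
Proof.
move=> dd1 dd2 [t1 [m1 [t1T ct1 ms1 dm1 qm1]]] /(_ m1 ms1 dm1 qm1)[t2 [m2 [t2T ct2 ms2 dm2 qm2]]].
exists (t1 + t2), m2; split=> //; first exact: leq_add.
  by rewrite addnC /exec iterD -/(exec p t1 c) ct1.
by move=> j jd; rewrite dm2 /= ?dm1 // (leq_trans jd).
Qed.

Lemma reaches_weaken p T T' d c l s (Q Q' : (nat -> nat) -> Prop) : T <= T' ->
  (forall m, agree_below d (regs c) m -> Q m -> Q' m) ->
  reaches p T d c l s Q -> reaches p T' d c l s Q'.
Proof.
move=> TT' QQ' [t [m [tT ct ms dm qm]]]; exists t, m; split=> //; last exact: QQ'.
exact: leq_trans TT'.
Qed.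

Lemma reaches_exec p t d c l s m : exec p t c = Config l m (out s) -> represents m s ->
  agree_below d (regs c) m -> reaches p t d c l s (eq m).
Proof. by exists t, m. Qed.

Lemma reaches_step p d c l s m : step p inp c = Config l m (out s) -> represents m s ->
  agree_below d (regs c) m -> reaches p 1 d c l s (eq m).
Proof. exact: (@reaches_exec p 1). Qed.

Lemma reaches_temp p d j l m l' s v : d <= j ->
  step p inp (Config l m (out s)) = Config l' (upd m (temp j) v) (out s) -> represents m s ->
  reaches p 1 d (Config l m (out s)) l' s (eq (upd m (temp j) v)).
Proof.
move=> dj step_l ms; apply: reaches_step => //; first exact: represents_temp.
exact: agree_below_upd.
Qed.

Lemma exec_address p a d d' l m s : d < d' -> placed p l (address a d d') -> represents m s ->
  reaches p stride.+1 d' (Config l m (out s)) (l + stride.+1) s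
    (fun m' => m' (temp d') = cell a (m (temp d))).
Proof.
move=> dd' /placed_cons[pl padd] ms; have dN : (d == d') = false by rewrite ltn_eqF.
have adds k l1 m1 : placed p l1 (nseq k (Iadd (temp d') (temp d') (temp d))) -> represents m1 s ->
    reaches p k d' (Config l1 m1 (out s)) (l1 + k) s
      (fun m' => m' (temp d') = m1 (temp d') + k * m1 (temp d)).
  elim: k l1 m1 => [|k IH] l1 m1; first by exists 0, m1; rewrite !addn0.
  move=> /placed_cons[pl1 pk] m1s; rewrite -add1n addnA addn1.
  apply: (reaches_bind (leqnn d') (leqnn d') (reaches_temp (l' := l1.+1) (leqnn d') _ _)) => //.
    by rewrite /= /current /= pl1.
  move=> m2 m2s _ def_m2; apply: reaches_weaken (IH _ _ pk m2s) => // m3 _ ->.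
  by rewrite -def_m2 !upd_temp eqxx dN mulSn addnA.
rewrite -add1n addnA addn1.
apply: (reaches_bind (leqnn d') (leqnn d') (reaches_temp (l' := l.+1) (leqnn d') _ _)) => //.
  by rewrite /= /current /= pl.
move=> m1 m1s _ def_m1; apply: reaches_weaken (adds _ _ _ padd m1s) => // m2 _ ->.
by rewrite -def_m1 !upd_temp eqxx dN addnC.
Qed.

Definition computes (q : program) (d : nat) (s : state) (v : nat) : Prop :=
  forall p l m, placed p l q -> represents m s ->
  reaches p (size q) d (Config l m (out s)) (l + size q) s (fun m' => m' (temp d) = v).

Lemma computes_nullary x d s v :
  (forall p l m o, nth Ihalt p l = x ->
    step p inp (Config l m o) = Config l.+1 (upd m (temp d) v) o) ->
  computes [:: x] d s v.
Proof.
move=> step_x p l m /placed_cons[pl _] ms; rewrite addn1.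
apply: reaches_weaken (reaches_temp (leqnn d) (step_x _ _ _ _ pl) ms) => // _ _ <-.
by rewrite upd_temp eqxx.
Qed.

Lemma computes_unary q x f d s v :
  (forall p l m o, nth Ihalt p l = x ->
    step p inp (Config l m o) = Config l.+1 (upd m (temp d) (f (m (temp d)))) o) ->
  computes q d s v -> computes (q ++ [:: x]) d s (f v).
Proof.
move=> step_x qv p l m /placed_cat[pq /placed_cons[px _]] ms.
rewrite size_cat addnA (addn1 (l + _)).
apply: (reaches_bind (leqnn d) (leqnn d) (qv p l m pq ms)) => m1 m1s _ m1v.
apply: reaches_weaken (reaches_temp (leqnn d) (step_x _ _ _ _ px) m1s) => // _ _ <-.
by rewrite upd_temp eqxx m1v.
Qed.

Lemma computes_binary q1 q2 x op d s v1 v2 :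
  (forall p l m o, nth Ihalt p l = x -> step p inp (Config l m o) =
    Config l.+1 (upd m (temp d) (op (m (temp d)) (m (temp d.+1)))) o) ->
  computes q1 d s v1 -> computes q2 d.+1 s v2 -> computes (q1 ++ q2 ++ [:: x]) d s (op v1 v2).
Proof.
move=> step_x qv1 qv2 p l m /placed_cat[pq1 /placed_cat[pq2 /placed_cons[px _]]] ms.
rewrite !size_cat !addnA (addn1 (l + _ + _)) -addnA.
apply: (reaches_bind (leqnn d) (leqnn d) (qv1 p l m pq1 ms)) => m1 m1s _ m1v.
apply: (reaches_bind (leqnSn d) (leqnn d) (qv2 p _ m1 pq2 m1s)) => m2 m2s m12 m2v.
apply: reaches_weaken (reaches_temp (leqnn d) (step_x _ _ _ _ px) m2s) => // _ _ <-.
by rewrite upd_temp eqxx m2v m12 //= m1v.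
Qed.

Lemma compile_expr_correct e d s : expr_ok e -> computes (compile_expr e d) d s (eval inp e s).
Proof.
elim: e d => [k||e IH|a e IH|e1 IH1 e2 IH2|e1 IH1 e2 IH2] d /=.
- by move=> _; apply: computes_nullary => p l m o pl; rewrite /= /current /= pl.
- by move=> _; apply: computes_nullary => p l m o pl; rewrite /= /current /= pl.
- move=> e_ok; apply: (@computes_unary _ _ (nth 0 inp)); last exact: IH.
  by move=> p l m o pl; rewrite /= /current /= pl.
- move=> /andP[a_lt e_ok] p l m /placed_cat[/placed_cat[pe pa] /placed_cons[pl _]] ms.
  rewrite !size_cat size_address !addnA (addn1 (l + _ + _)) -addnA.
  apply: (reaches_bind (leqnn d) (leqnn d) (IH d e_ok p l m pe ms)) => m1 m1s _ m1v.
  apply: (reaches_bind (leqnSn d) (leqnn d) (exec_address (ltnSn d) pa m1s)) => m2 m2s m12 m2v.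
  rewrite size_cat size_address addnA in pl.
  apply: reaches_weaken (reaches_temp (leqnn d) (_ : _ = Config _ (upd m2 (temp d) _) _) m2s) => //.
    by move=> _ _ <-; rewrite upd_temp eqxx.
  by rewrite /= /current /= pl m2v m2s // m1v.
- case/andP=> ok1 ok2; apply: (@computes_binary _ _ _ addn); [|exact: IH1|exact: IH2].
  by move=> p l m o pl; rewrite /= /current /= pl.
- case/andP=> ok1 ok2; apply: (@computes_binary _ _ _ subn); [|exact: IH1|exact: IH2].
  by move=> p l m o pl; rewrite /= /current /= pl.
Qed.

Definition executes (c : cmd) : Prop :=
  forall d p l m s, placed p l (compile c d l) -> represents m s ->
  reaches p (time c (size inp).+1) d (Config l m (out s)) (l + size (compile c d l))
    (sem inp c s) (fun _ => True).

Lemma executes_store a e1 e2 : a.+1 < stride -> expr_ok e1 -> expr_ok e2 ->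
  executes (Store a e1 e2).
Proof.
move=> a_lt ok1 ok2 d p l m s.
move=> /placed_cat[/placed_cat[pe1 /placed_cat[pe2 pa]] /placed_cons[pl _]] ms.
rewrite [time _ _]/= -(size_compile_expr e1 d) -(size_compile_expr e2 d.+1).
set k1 := size (compile_expr e1 d) in pe1 pe2 *; set k2 := size (compile_expr e2 d.+1) in pa *.
rewrite (_ : l + size _ = (l + k1 + k2 + stride.+1).+1); last first.
  by rewrite /= !size_cat size_address /= -/k1 -/k2; lia.
rewrite (_ : l + size _ = l + k1 + k2 + stride.+1) in pl; last first.
  by rewrite !size_cat size_address -/k1 -/k2 !addnA.
apply: (reaches_bind (leqnn d) (leqnn d) (compile_expr_correct ok1 pe1 ms)) => m1 m1s _ m1v.
apply: (reaches_bind (leqnSn d) (leqnn d) (compile_expr_correct ok2 pe2 m1s)) => m2 m2s m12 m2v.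
have dd2 : d < d.+2 by [].
apply: (reaches_bind (ltnW dd2) (leqnn d) (exec_address dd2 pa m2s)) => m3 m3s m23 m3v.
have step_l : step p inp (Config (l + k1 + k2 + stride.+1) m3 (out s)) =
    Config (l + k1 + k2 + stride.+1).+1
      (upd m3 (cell a (eval inp e1 s)) (eval inp e2 s)) (out s).
  by rewrite /= /current /= pl m3v m23 //= m2v m12 //= m1v.
apply: reaches_weaken (@reaches_step p d _ _ (set_arr s a _ _) _ step_l _ _) => //.
  exact: represents_cell.
by move=> j jd; rewrite /upd eq_sym cell_temp.
Qed.

Lemma executes_seq c1 c2 : executes c1 -> executes c2 -> executes (c1 ;; c2).
Proof.
move=> ex1 ex2 d p l m s /placed_cat[p1 p2] ms; rewrite /= size_cat addnA.
apply: (reaches_bind (leqnn d) (leqnn d) (ex1 _ _ _ _ _ p1 ms)) => m1 m1s _ _.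
exact: ex2.
Qed.

Lemma executes_if e c1 c2 : expr_ok e -> executes c1 -> executes c2 -> executes (If e c1 c2).
Proof.
move=> e_ok ex1 ex2 d p l m s; rewrite [compile _ _ _]/=.
set pe := compile_expr e d; set p2 := compile c2 _ _; set l1 := (_ + _).+1.
set p1 := compile c1 _ _; case/placed_cat=> ppe /placed_cons[p_zero /placed_cons[p_test]].
case/placed_cat=> pp2 /placed_cons[p_skip pp1] ms.
rewrite [time _ _]/= -(size_compile_expr e d) -/pe [sem _ _ _]/=.
rewrite (_ : l + size _ = l1 + size p1); last by rewrite !size_cat /= !size_cat /= /l1; lia.
apply: (reaches_bind (leqnn d) (leqnn d) (compile_expr_correct e_ok ppe ms)) => m1 m1s _ m1v.
have test : reaches p 2 d (Config (l + size pe) m1 (out s))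
    (if 0 < eval inp e s then l1 else (l + size pe).+2) s (fun _ => True).
  rewrite -[2]/(1 + 1).
  apply: (reaches_bind (leqnSn d) (leqnn d)
    (reaches_temp (l' := (l + size pe).+1) (leqnn d.+1) _ m1s)).
    by rewrite /= /current /= p_zero.
  move=> m2 m2s _ def_m2.
  apply: reaches_weaken (reaches_step (m := m2) _ m2s _) => //=.
  rewrite /current /= p_test -def_m2 !upd_temp eqxx (ltn_eqF (ltnSn d)) m1v.
  by case: ifP.
apply: (reaches_bind (leqnn d) (leqnn d) test) => m2 m2s _ _.
case: ifP => _.
  apply: reaches_weaken (ex1 _ _ _ _ _ pp1 m2s) => //.
  by rewrite -addnA leq_addr.
apply: (reaches_bind (T1 := _ + _) (leqnn d) (leqnn d)).
  apply: reaches_weaken (ex2 _ _ _ _ _ pp2 m2s); first exact: leq_addl.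
  by move=> *; exact: I.
move=> m3 m3s _ _; apply: reaches_weaken (reaches_step (m := m3) _ m3s _) => //.
by rewrite /= /current /= p_skip.
Qed.

Lemma executes_write e : expr_ok e -> executes (Write e).
Proof.
move=> e_ok d p l m s /placed_cat[pe /placed_cons[pw _]] ms.
rewrite /= size_cat addnA -(size_compile_expr e d).
apply: (reaches_bind (leqnn d) (leqnn d) (compile_expr_correct e_ok pe ms)) => m1 m1s _ m1v.
apply: reaches_weaken (reaches_step (m := m1) _ _ _) => //.
by rewrite /= /current /= pw m1v addn1.
Qed.

Section Iterations.
Variables (c : cmd) (d l : nat) (p : program).
Hypothesis c_exec : executes c.
Hypothesis p_body : placed p l (compile c d.+1 l ++ countdown d l).
Local Notation T := (time c (size inp).+1).
Local Notation l_end := (l + size (compile c d.+1 l) + 4).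

Lemma executes_iteration k m s : m (temp d) = k.+1 -> represents m s ->
  reaches p (T + 4) d (Config l m (out s)) (if 0 < k then l else l_end)
    (sem inp c s) (fun m' => m' (temp d) = k).
Proof.
case/placed_cat: p_body => p_c.
case/placed_cons=> p_one /placed_cons[p_decr /placed_cons[p_zero /placed_cons[p_jump _]]] mk ms.
have dN : (d == d.+1) = false by rewrite ltn_eqF.
apply: (reaches_bind (leqnSn d) (leqnn d) (c_exec p_c ms)) => m1 m1s m_m1 _.
pose m2 := upd (upd (upd m1 (temp d.+1) 1) (temp d) k) (temp d.+1) 0.
apply: reaches_weaken (reaches_exec (t := 4) (m := m2) _ _ _) => //.
- by move=> _ _ <-; rewrite /m2 !upd_temp dN eqxx.
- rewrite execS /step /current /= p_one execS /step /current /= p_decr.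
  rewrite execS /step /current /= p_zero !upd_temp eqxx dN m_m1 //= mk subn1 /=.
  by rewrite execS /step /current /= p_jump !upd_temp eq_sym dN !eqxx addn4; case: ifP.
- by do 3!apply: represents_temp.
- by do 3!apply: agree_below_upd => //.
Qed.

Lemma executes_iterations k m s : m (temp d) = k.+1 -> represents m s ->
  reaches p (k.+1 * (T + 4)) d (Config l m (out s)) l_end
    (iter k.+1 (sem inp c) s) (fun _ => True).
Proof.
elim: k m s => [|k IH] m s mk ms.
  by rewrite mul1n; apply: reaches_weaken (executes_iteration mk ms).
rewrite mulSn iterSr.
by apply: (reaches_bind (leqnn d) (leqnn d) (executes_iteration mk ms)) => m1 m1s _ /IH; apply.
Qed.

End Iterations.

Lemma executes_rep c : executes c -> executes (Rep c).
Proof.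
move=> c_exec d p l m s; rewrite [compile _ _ _]/= addn3.
case/placed_cons=> p_len /placed_cons[p_one /placed_cons[p_succ p_body]] ms.
rewrite (_ : l + _ = l.+3 + size (compile c d.+1 l.+3) + 4); last by rewrite /= size_cat /=; lia.
pose m1 := upd (upd (upd m (temp d) (size inp)) (temp d.+1) 1) (temp d) (size inp).+1.
apply: (reaches_bind (T1 := 3) (leqnn d) (leqnn d) (reaches_exec (m := m1) (l := l.+3) _ _ _)).
- rewrite execS /step /current /= p_len execS /step /current /= p_one.
  by rewrite execS /step /current /= p_succ !upd_temp !eqxx ltn_eqF // addn1.
- by do 3!apply: represents_temp.
- by do 3!apply: agree_below_upd => //.
move=> m2 m2s _ def_m2; apply: executes_iterations => //.
by rewrite -def_m2 /m1 upd_temp eqxx.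
Qed.

Lemma compile_correct c : cmd_ok c -> executes c.
Proof.
elim: c => [|a e1 e2|c1 IH1 c2 IH2|e c1 IH1 c2 IH2|c IH|e] /=.
- by move=> _ d p l m s _ ms; exists 0, m; rewrite addn0.
- by case/and3P; apply: executes_store.
- by case/andP=> /IH1 ex1 /IH2; apply: executes_seq.
- by case/and3P=> e_ok /IH1 ex1 /IH2; apply: executes_if.
- by move/IH; apply: executes_rep.
- exact: executes_write.
Qed.

End Compiler.

Definition poly_bounded (f : nat -> nat) : Prop :=
  exists C d, forall N, 0 < N -> f N <= C * N ^ d.

Lemma poly_bounded_const k : poly_bounded (fun _ => k).
Proof. by exists k, 0 => N _; rewrite expn0 muln1. Qed.

Lemma poly_bounded_add f g : poly_bounded f -> poly_bounded g ->
  poly_bounded (fun N => f N + g N).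
Proof.
move=> [C1 [d1 fC]] [C2 [d2 gC]]; exists (C1 + C2), (d1 + d2) => N N0.
rewrite mulnDl leq_add //.
  by apply: leq_trans (fC N N0) _; rewrite leq_mul2l leq_pexp2l ?orbT ?leq_addr.
by apply: leq_trans (gC N N0) _; rewrite leq_mul2l leq_pexp2l ?orbT ?leq_addl.
Qed.

Lemma poly_bounded_mulr f : poly_bounded f -> poly_bounded (fun N => N * f N).
Proof.
by move=> [C [d fC]]; exists C, d.+1 => N N0; rewrite expnS mulnCA leq_mul2l fC ?orbT.
Qed.

Lemma poly_bounded_time stride c : poly_bounded (time stride c).
Proof.
have const := poly_bounded_const; have add := poly_bounded_add.
elim: c => [|a e1 e2|c1 IH1 c2 IH2|e c1 IH1 c2 IH2|c IH|e]; try exact: const.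
- exact: add.
- exact: add (const _) (add _ _ (const 2) (add _ _ (add _ _ IH1 IH2) (const 1))).
- exact: add (const 3) (poly_bounded_mulr (add _ _ IH (const 4))).
Qed.

Lemma size_input_size (inp : seq nat) : size inp <= input_size inp.
Proof.
rewrite /input_size -sum1_size; elim: inp => [|x s IH]; first by rewrite !big_nil.
by rewrite !big_cons leq_add.
Qed.

Lemma expnS_bound k d : k.+1 ^ d <= 2 ^ d * k ^ d + 2 ^ d.
Proof.
case: k => [|k]; first by rewrite exp1n (leq_trans _ (leq_addl _ _)) // expn_gt0.
apply: leq_trans (leq_addr _ _); rewrite -expnMn.
by case: d => // d; rewrite leq_exp2r //; lia.
Qed.

Theorem loop_program_polytime (R : seq nat -> seq nat -> Prop) (c : cmd) (stride : nat) :
  0 < stride -> cmd_ok stride c ->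
  (forall inp, R inp (out (sem inp c (State (fun _ _ => 0) [::])))) ->
  polytime_solvable R.
Proof.
move=> stride_gt0 c_ok cR; have [C [d c_time]] := poly_bounded_time stride c.
exists (compile stride c 0 0), (C * 2 ^ d), d => inp.
have placed_c : placed (compile stride c 0 0) 0 (compile stride c 0 0) by move=> i _.
have init_c : represents stride (fun _ => 0) (State (fun _ _ => 0) [::]) by [].
have [t [m [t_le c_t _ _ _]]] := compile_correct inp stride_gt0 c_ok placed_c init_c.
exists t; rewrite -[run _ _ _]/(exec inp _ t (Config 0 (fun _ => 0) [::])) c_t.
split; last exact: cR.
- apply: leq_trans t_le (leq_trans (c_time _ (ltn0Sn _)) _).
  rewrite -mulnA -mulnDr leq_mul2l; apply/orP; right.
  apply: leq_trans (expnS_bound _ _).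
  by case: d {c_time} => // d; rewrite leq_exp2r // ltnS size_input_size.
- by rewrite /halted /current /= add0n nth_default.
Qed.

(** * Reasoning about loop programs *)

Fixpoint mods (c : cmd) : seq nat :=
  match c with
  | Skip | Write _ => [::]
  | Store a _ _ => [:: a]
  | c1 ;; c2 | If _ c1 c2 => mods c1 ++ mods c2
  | Rep c => mods c
  end.

Fixpoint silent (c : cmd) : bool :=
  match c with
  | Skip | Store _ _ _ => true
  | Write _ => false
  | c1 ;; c2 | If _ c1 c2 => silent c1 && silent c2
  | Rep c => silent c
  end.

Definition agree (L : seq nat) (s s' : state) : Prop :=
  forall a i, a \notin L -> arr s' a i = arr s a i.

Lemma agree_set L s s' a i v : a \in L -> agree L s s' -> agree L s (set_arr s' a i v).
Proof.
move=> aL ss' b j bL /=; rewrite ifN ?ss' //.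
by apply: contra bL => /andP[/eqP->].
Qed.

Lemma agree_set1 s a i v : agree [:: a] s (set_arr s a i v).
Proof. by apply: agree_set; rewrite ?mem_head. Qed.

Lemma agree_trans L s1 s2 s3 : agree L s1 s2 -> agree L s2 s3 -> agree L s1 s3.
Proof. by move=> s12 s23 a i aL; rewrite s23 ?s12. Qed.

Lemma agree_sub L L' s s' : {subset L <= L'} -> agree L s s' -> agree L' s s'.
Proof. by move=> LL' ss' a i aL'; apply: ss'; apply: contra aL' => /LL'. Qed.

Definition Var (a : nat) : expr := Get a (Const 0).
Definition Assign (a : nat) (e : expr) : cmd := Store a (Const 0) e.

(* An expression is true when it is nonzero. *)
Definition Less (e1 e2 : expr) : expr := Minus e2 e1.
Definition Not (e : expr) : expr := Minus (Const 1) e.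
Definition Or (e1 e2 : expr) : expr := Plus e1 e2.
Definition And (e1 e2 : expr) : expr := Not (Or (Not e1) (Not e2)).
Definition Equal (e1 e2 : expr) : expr := Not (Or (Less e1 e2) (Less e2 e1)).
Definition When (e : expr) (c : cmd) : cmd := If e c Skip.

Definition For (x k : nat) (stp : expr) (c : cmd) : cmd :=
  Assign x (Const 0) ;; iter k Rep (c ;; Assign x (Plus (Var x) stp)).

Definition Successor (e : expr) : expr := Plus e (Const 1).

(* Vertices are the numbers up to the input length; the table of matchings consists of
   [(size inp).+1 ^ 4] slots of [(size inp).+1] cells. *)
Definition ForVertex (x : nat) (c : cmd) : cmd := For x 1 (Const 1) c.
Definition ForSlot (x : nat) (c : cmd) : cmd := For x 4 (Successor Len) c.

Section Rules.
Variable inp : seq nat.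
Local Notation N := (size inp).+1.
Implicit Types (c : cmd) (e : expr) (s : state) (x a : nat).

Definition holds e s : bool := 0 < eval inp e s.

Lemma holds_less e1 e2 s : holds (Less e1 e2) s = (eval inp e1 s < eval inp e2 s).
Proof. exact: subn_gt0. Qed.

Lemma holds_not e s : holds (Not e) s = ~~ holds e s.
Proof. by rewrite /holds /=; case: (eval inp e s). Qed.

Lemma holds_or e1 e2 s : holds (Or e1 e2) s = holds e1 s || holds e2 s.
Proof. exact: addn_gt0. Qed.

Lemma holds_and e1 e2 s : holds (And e1 e2) s = holds e1 s && holds e2 s.
Proof. by rewrite holds_not holds_or !holds_not negb_or !negbK. Qed.

Lemma holds_equal e1 e2 s : holds (Equal e1 e2) s = (eval inp e1 s == eval inp e2 s).
Proof. by rewrite holds_not holds_or !holds_less -neq_ltn negbK. Qed.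

Definition holdsE := (holds_and, holds_equal, holds_or, holds_not, holds_less).

Lemma sem_seq c1 c2 s : sem inp (c1 ;; c2) s = sem inp c2 (sem inp c1 s).
Proof. by []. Qed.

Lemma sem_assign a e s : sem inp (Assign a e) s = set_arr s a 0 (eval inp e s).
Proof. by []. Qed.

Lemma sem_when e c s : sem inp (When e c) s = if holds e s then sem inp c s else s.
Proof. by []. Qed.

Lemma sem_frame c s : agree (mods c) s (sem inp c s).
Proof.
elim: c s => //= [a e1 e2|c1 IH1 c2 IH2|e c1 IH1 c2 IH2|c IH] s b i.
- by rewrite inE => /negPf ab /=; rewrite ab.
- by rewrite mem_cat => /norP[b1 b2]; rewrite IH2 // IH1.
- by rewrite mem_cat => /norP[b1 b2]; case: ifP => _; [rewrite IH1|rewrite IH2].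
- by move=> bc; rewrite IH //; elim: (size inp) => //= k IHk; rewrite IH.
Qed.

Lemma sem_silent c s : silent c -> out (sem inp c s) = out s.
Proof.
elim: c s => //= [c1 IH1 c2 IH2|e c1 IH1 c2 IH2|c IH] s.
- by case/andP=> s1 s2; rewrite IH2 // IH1.
- by case/andP=> s1 s2; case: ifP => _; [rewrite IH1|rewrite IH2].
- by move=> cs; rewrite IH //; elim: (size inp) => //= k IHk; rewrite IH.
Qed.

Lemma sem_iter_rep k c s : sem inp (iter k Rep c) s = iter (N ^ k) (sem inp c) s.
Proof.
elim: k s => //= k IH s.
have iterM j t : iter j (sem inp (iter k Rep c)) t = iter (j * N ^ k) (sem inp c) t.
  by elim: j => //= j ->; rewrite IH mulSn iterD.
by rewrite -iterS iterM expnS.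
Qed.

Lemma for_rule x k stp st c (I : nat -> state -> Prop) s :
  (forall s', eval inp stp s' = st) -> x \notin mods c ->
  (forall i s' v, I i s' -> I i (set_arr s' x 0 v)) -> I 0 s ->
  (forall i s', i < N ^ k -> agree (x :: mods c) s s' -> arr s' x 0 = i * st -> I i s' ->
     I i.+1 (sem inp c s')) ->
  I (N ^ k) (sem inp (For x k stp c) s).
Proof.
move=> stpE xc Ix I0 IS; rewrite /For sem_seq sem_iter_rep.
set body := sem inp (c ;; _); set s0 := sem inp _ s.
suff : forall i, i <= N ^ k -> [/\ agree (x :: mods c) s (iter i body s0),
    arr (iter i body s0) x 0 = i * st & I i (iter i body s0)].
  by move=> /(_ _ (leqnn _))[].
elim=> [|i IH] ik.
  by split; [apply: agree_set; rewrite ?mem_head | rewrite /= !eqxx | apply: Ix].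
have [ag xi Ii] := IH (ltnW ik); rewrite iterS; move: (iter i body s0) ag xi Ii => s' ag xi Ii.
split; last by apply: Ix; apply: IS.
- apply: agree_set; first exact: mem_head.
  apply: agree_trans ag (agree_sub _ (@sem_frame c s')) => a ac.
  by rewrite inE ac orbT.
- by rewrite /= !eqxx stpE sem_frame // xi mulSn addnC.
Qed.

Lemma for_vertex_rule x c (I : nat -> state -> Prop) s : x \notin mods c ->
  (forall i s' v, I i s' -> I i (set_arr s' x 0 v)) -> I 0 s ->
  (forall (v : 'I_N) s', agree (x :: mods c) s s' -> arr s' x 0 = v -> I v s' ->
     I v.+1 (sem inp c s')) ->
  I N (sem inp (ForVertex x c) s).
Proof.
move=> xc Ix I0 IS; rewrite -[X in I X](expn1 N).
apply: (for_rule (st := 1)) => // i s'; rewrite expn1 muln1 => iN.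
exact: (IS (Ordinal iN)).
Qed.

Lemma for_slot_rule x c (I : nat -> state -> Prop) s : x \notin mods c ->
  (forall i s' v, I i s' -> I i (set_arr s' x 0 v)) -> I 0 s ->
  (forall (q : 'I_(N ^ 4)) s', agree (x :: mods c) s s' -> arr s' x 0 = q * N -> I q s' ->
     I q.+1 (sem inp c s')) ->
  I (N ^ 4) (sem inp (ForSlot x c) s).
Proof.
move=> xc Ix I0 IS; apply: (for_rule (st := N)) => // [s'|i s' iN].
  by rewrite /= addn1.
exact: (IS (Ordinal iN)).
Qed.

End Rules.

Definition Nest (xs : seq nat) (c : cmd) : cmd := foldr ForVertex c xs.

Section Nest.
Variable inp : seq nat.
Local Notation N := (size inp).+1.
Implicit Types (ds : seq 'I_N) (xs : seq nat) (s : state).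

Definition append_digit (q : nat) (d : 'I_N) : nat := q * N + d.
Definition code ds : nat := foldl append_digit 0 ds.

Lemma divmod_digit q (d : 'I_N) : ((q * N + d) %/ N = q) * ((q * N + d) %% N = d).
Proof. by rewrite divnMDl // modnMDl divn_small ?modn_small ?addn0. Qed.

Lemma digit_inj q q' (d d' : 'I_N) : q * N + d = q' * N + d' -> q = q' /\ d = d'.
Proof.
move=> eq_digit; have := divmod_digit q d; rewrite eq_digit !divmod_digit => -[-> /val_inj ->].
by [].
Qed.

Lemma code_rcons ds d : code (rcons ds d) = code ds * N + d.
Proof. by rewrite /code foldl_rcons. Qed.

Lemma code_lt ds : code ds < N ^ size ds.
Proof.
elim/last_ind: ds => [|ds d IH]; first by rewrite expn_gt0.
rewrite code_rcons size_rcons expnSr (leq_trans _ (leq_mul IH (leqnn N))) //.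
by rewrite mulSn addnC ltn_add2r.
Qed.

Lemma code_inj ds ds' : size ds = size ds' -> code ds = code ds' -> ds = ds'.
Proof.
elim/last_ind: ds ds' => [|ds d IH]; first by case.
case/lastP => [|ds' d']; first by rewrite size_rcons.
by rewrite !size_rcons !code_rcons => -[/IH ds_ds'] /digit_inj[/ds_ds'-> ->].
Qed.

Definition valuation xs ds s : Prop := [seq arr s x 0 | x <- xs] = [seq nat_of_ord d | d <- ds].

Lemma mem_mods_nest xs c x : (x \in mods (Nest xs c)) = (x \in xs) || (x \in mods c).
Proof.
elim: xs => [|y xs IH] //=; rewrite !(inE, mem_cat) IH /=.
by case: (x == y); rewrite ?orbT ?orbF.
Qed.

Lemma nest_rule_from q xs c (I : nat -> state -> Prop) s :
  uniq xs -> (forall x, x \in xs -> x \notin mods c) ->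
  (forall k x s' v, x \in xs -> I k s' -> I k (set_arr s' x 0 v)) -> I (q * N ^ size xs) s ->
  (forall ds s', size ds = size xs -> valuation xs ds s' -> let k := foldl append_digit q ds in
     I k s' -> I k.+1 (sem inp c s')) ->
  I (q.+1 * N ^ size xs) (sem inp (Nest xs c) s).
Proof.
elim: xs q I s => [|x xs IH] q I s /=.
  by rewrite expn0 !muln1 => _ _ _ I0 /(_ [::] s erefl erefl I0).
case/andP=> x_xs xs_uniq xsc Ixs; rewrite expnS !mulnA mulSn addnC => I0 IS.
pose J k s' := I ((q * N + k) * N ^ size xs) s'.
apply: (for_vertex_rule (I := J)); rewrite /J.
- by rewrite mem_mods_nest negb_or x_xs xsc ?mem_head.
- by move=> k s' v; apply: Ixs; apply: mem_head.
- by rewrite addn0.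
move=> v s' _ s'x; rewrite addnS => Is'.
pose Jx k s'' := I k s'' /\ arr s'' x 0 = v.
suff [] : Jx ((q * N + v).+1 * N ^ size xs) (sem inp (Nest xs c) s') by [].
apply: IH => // [y yxs|k y s'' w yxs [Ik xv]|ds s'' size_ds val_ds k [Ik xv]].
- by apply: xsc; rewrite inE yxs orbT.
- split; first by apply: Ixs; rewrite // inE yxs orbT.
  by rewrite /= ifN // negb_and; apply/orP; left; apply: contraNneq x_xs => ->.
- split; last by rewrite sem_frame // xsc ?mem_head.
  by apply: (IS (v :: ds)) => //=; [rewrite size_ds | rewrite /valuation /= xv val_ds].
Qed.

Lemma nest_rule xs c (I : nat -> state -> Prop) s :
  uniq xs -> (forall x, x \in xs -> x \notin mods c) ->
  (forall k x s' v, x \in xs -> I k s' -> I k (set_arr s' x 0 v)) -> I 0 s ->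
  (forall ds s', size ds = size xs -> valuation xs ds s' -> I (code ds) s' ->
     I (code ds).+1 (sem inp c s')) ->
  I (N ^ size xs) (sem inp (Nest xs c) s).
Proof.
move=> xs_uniq xsc Ixs I0 IS; rewrite -[N ^ _]mul1n.
by apply: nest_rule_from => //; rewrite mul0n.
Qed.

End Nest.

(** * Elementary loops *)

Notation vIdx := 0 (only parsing).
Notation vScan := 1 (only parsing).

Definition FillIf (a : nat) (b c e1 e2 : expr) : cmd :=
  ForVertex vIdx (If c (Store a (Plus b (Var vIdx)) e1) (Store a (Plus b (Var vIdx)) e2)).

Definition Fill (a : nat) (b e : expr) : cmd := FillIf a b (Const 1) e e.

Definition Count (a : nat) (c : expr) : cmd :=
  Assign a (Const 0) ;; ForVertex vIdx (When c (Assign a (Successor (Var a)))).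

Definition FindLast (a : nat) (c e : expr) : cmd :=
  ForVertex vScan (When c (Assign a e)).

Section ElementaryLoops.
Variable inp : seq nat.
Local Notation N := (size inp).+1.
Implicit Types (a : nat) (b c e : expr) (s : state).

Lemma fill_if_block a b c e1 e2 s q (F : 'I_N -> nat) : a != vIdx ->
  (forall s', agree [:: vIdx; a] s s' -> eval inp b s' = q * N) ->
  (forall (v : 'I_N) s', agree [:: vIdx; a] s s' -> arr s' vIdx 0 = v ->
     eval inp (if holds inp c s' then e1 else e2) s' = F v) ->
  forall q' (v : 'I_N), arr (sem inp (FillIf a b c e1 e2) s) a (q' * N + v) =
    if q' == q then F v else arr s a (q' * N + v).
Proof.
move=> aI bE cE.
pose I k s' := forall q' (v : 'I_N), arr s' a (q' * N + v) =
  if (q' == q) && (v < k) then F v else arr s a (q' * N + v).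
suff filled : I N (sem inp (FillIf a b c e1 e2) s).
  by move=> q' v; rewrite filled ltn_ord andbT.
apply: for_vertex_rule.
- by rewrite /= !inE orbb eq_sym.
- by move=> k s' w Ik q' v; rewrite /= (negPf aI) Ik.
- by move=> q' v; rewrite ltn0 andbF.
move=> v s' ag_if s'v Iv q' w.
have ag : agree [:: vIdx; a] s s' by apply: agree_sub ag_if => x; rewrite !inE orbb.
have -> : sem inp (If c (Store a (Plus b (Var vIdx)) e1) (Store a (Plus b (Var vIdx)) e2)) s' =
    set_arr s' a (q * N + v) (F v).
  by rewrite -(cE v s' ag s'v) /= bE // s'v /holds; case: ifP.
rewrite /= eqxx Iv /=; case: eqP => [/digit_inj[-> ->]|neq]; first by rewrite eqxx ltnSn.
case: (eqVneq q' q) => [eq_q|_] //=; rewrite ltnS [w <= v]leq_eqVlt.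
by case: (eqVneq (w : nat) v) => [eq_v|_] //; case: neq; rewrite eq_q eq_v.
Qed.

Lemma fill_block a b e s q (F : 'I_N -> nat) : a != vIdx ->
  (forall s', agree [:: vIdx; a] s s' -> eval inp b s' = q * N) ->
  (forall (v : 'I_N) s', agree [:: vIdx; a] s s' -> arr s' vIdx 0 = v -> eval inp e s' = F v) ->
  forall q' (v : 'I_N), arr (sem inp (Fill a b e) s) a (q' * N + v) =
    if q' == q then F v else arr s a (q' * N + v).
Proof. by move=> aI bE eE; apply: fill_if_block. Qed.

Lemma fill_if_vertex a c e1 e2 s (F : 'I_N -> nat) : a != vIdx ->
  (forall (v : 'I_N) s', agree [:: vIdx; a] s s' -> arr s' vIdx 0 = v ->
     eval inp (if holds inp c s' then e1 else e2) s' = F v) ->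
  forall v : 'I_N, arr (sem inp (FillIf a (Const 0) c e1 e2) s) a v = F v.
Proof. by move=> aI cE v; apply: (@fill_if_block a (Const 0) c e1 e2 s 0 F aI _ cE 0 v). Qed.

Lemma fill_vertex a e s (F : 'I_N -> nat) : a != vIdx ->
  (forall (v : 'I_N) s', agree [:: vIdx; a] s s' -> arr s' vIdx 0 = v -> eval inp e s' = F v) ->
  forall v : 'I_N, arr (sem inp (Fill a (Const 0) e) s) a v = F v.
Proof. by move=> aI eE; apply: fill_if_vertex. Qed.

Lemma count_card a c s (P : pred 'I_N) : a != vIdx ->
  (forall (v : 'I_N) s', agree [:: vIdx; a] s s' -> arr s' vIdx 0 = v -> holds inp c s' = P v) ->
  arr (sem inp (Count a c) s) a 0 = #|P|.
Proof.
move=> aI cE; pose I k s' := arr s' a 0 = #|[pred v : 'I_N | (v < k) && P v]|.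
suff : I N (sem inp (Count a c) s).
  by rewrite /I => ->; apply: eq_card => v; rewrite !inE ltn_ord.
rewrite /Count sem_seq; apply: for_vertex_rule.
- by rewrite /= !inE eq_sym.
- by move=> k s' w; rewrite /I /= (negPf aI).
- by rewrite /I /= !eqxx; apply/esym/eq_card0 => v; rewrite inE.
move=> v s' ag s'v; rewrite /I sem_when (cE v) //; last first.
  move=> b i bN; rewrite ag //= ifN //; apply: contra bN => /andP[/eqP-> _].
  by rewrite !inE eqxx orbT.
have -> : #|[pred w : 'I_N | (w < v.+1) && P w]| = P v + #|[pred w : 'I_N | (w < v) && P w]|.
  rewrite (cardD1 v) inE ltnSn; congr (_ + _); apply: eq_card => w.
  by rewrite !inE andbA [in RHS]ltn_neqAle ltnS.
by move=> <-; case: ifP => _; rewrite /= ?eqxx ?addn1.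
Qed.

Lemma find_last a c e s (P : pred nat) (f : nat -> nat) : a != vScan ->
  (forall (v : 'I_N) s', agree [:: vScan; a] s s' -> arr s' vScan 0 = v ->
     holds inp c s' = P v /\ eval inp e s' = f v) ->
  arr (sem inp (FindLast a c e) s) a 0 = last (arr s a 0) [seq f v | v <- iota 0 N & P v].
Proof.
move=> aS cE.
apply: (for_vertex_rule (I := fun k s' =>
  arr s' a 0 = last (arr s a 0) [seq f v | v <- iota 0 k & P v])) => //.
- by rewrite /= inE eq_sym.
- by move=> k s' w; rewrite /= (negPf aS).
move=> v s' ag s'v Iv; have [cP ef] := cE v s' ag s'v.
rewrite -addn1 iotaD add0n filter_cat map_cat last_cat -Iv sem_when cP /=.
by case: ifP => //= _; rewrite !eqxx ef.
Qed.

End ElementaryLoops.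

(** * Computing maximum matchings *)

Notation aWalk := 2 (only parsing).
Notation aTable := 3 (only parsing).
Notation aCand := 4 (only parsing).
Notation aRestr := 5 (only parsing).
Notation aAvoid := 6 (only parsing).
Notation aMark := 7 (only parsing).
Notation vSlot := 8 (only parsing).
Notation vSlot1 := 9 (only parsing).
Notation vSlot2 := 10 (only parsing).
Notation vEdge := 11 (only parsing).
Notation vStart := 12 (only parsing).
Notation vKey1 := 13 (only parsing).
Notation vKey2 := 14 (only parsing).
Notation vKey3 := 15 (only parsing).
Notation vKey4 := 16 (only parsing).
Notation vCur := 17 (only parsing).
Notation vNew := 18 (only parsing).
Notation vOld := 19 (only parsing).

Definition key_vars : seq nat := [:: vKey1; vKey2; vKey3; vKey4].

Definition MarkKeys (xs : seq nat) : cmd :=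
  foldr (fun x c => Store aAvoid (Var x) (Const 1) ;; c) Skip xs.

Definition MarkAvoided : cmd := Fill aAvoid (Const 0) (Const 0) ;; MarkKeys key_vars.

Definition RestrictCandidate : cmd :=
  FillIf aRestr (Const 0) (Or (Get aAvoid (Var vIdx)) (Get aAvoid (Get aCand (Var vIdx))))
    (Var vIdx) (Get aCand (Var vIdx)).

Definition Mate (x : nat) (e : expr) : expr := Get aTable (Plus (Var x) e).

Definition CountPairs (a : nat) (mate : expr) : cmd := Count a (Less (Var vIdx) mate).

Definition CompareSizes : cmd :=
  CountPairs vNew (Get aRestr (Var vIdx)) ;; CountPairs vOld (Mate vSlot (Var vIdx)).

Definition KeepBetter : cmd :=
  CompareSizes ;;
  When (Less (Var vOld) (Var vNew)) (Fill aTable (Var vSlot) (Get aRestr (Var vIdx))).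

Definition Offer : cmd := MarkAvoided ;; RestrictCandidate ;; KeepBetter.

Definition Register : cmd :=
  Assign vSlot (Const 0) ;;
  Nest key_vars (Offer ;; Assign vSlot (Plus (Var vSlot) (Successor Len))).

Definition EdgeStart : expr := Get aWalk (Var vEdge).
Definition EdgeEnd : expr := Get aWalk (Successor (Var vEdge)).

Definition EdgeFree : expr :=
  And (Not (Equal EdgeStart EdgeEnd)) (And EdgeStart (And EdgeEnd
    (And (Equal (Get aCand EdgeStart) EdgeStart) (Equal (Get aCand EdgeEnd) EdgeEnd)))).

Definition CopyMates : cmd := Fill aCand (Const 0) (Mate vSlot1 (Var vIdx)).

Definition AddEdge : cmd :=
  CopyMates ;; When EdgeFree (Store aCand EdgeStart EdgeEnd ;; Store aCand EdgeEnd EdgeStart).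

Definition StartFree : expr :=
  Or (Equal (Mate vSlot1 (Var vStart)) (Var vStart))
     (Equal (Mate vSlot2 (Var vStart)) (Var vStart)).

Definition MarkNext : cmd :=
  Store aMark (Var vCur) (Const 1) ;; Assign vCur (Mate vSlot1 (Mate vSlot2 (Var vCur))).

Definition MarkComponent : cmd := Assign vCur (Var vStart) ;; ForVertex vScan MarkNext.

Definition MarkExchanged : cmd :=
  Fill aMark (Const 0) (Const 0) ;; When StartFree MarkComponent.

Definition Exchange : cmd :=
  MarkExchanged ;;
  FillIf aCand (Const 0) (Get aMark (Var vIdx)) (Mate vSlot1 (Var vIdx)) (Mate vSlot2 (Var vIdx)).

Definition AugmentPass : cmd := ForVertex vEdge (AddEdge ;; Register).
Definition ExchangePass : cmd := ForSlot vSlot2 (ForVertex vStart (Exchange ;; Register)).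
Definition Pass : cmd := ForSlot vSlot1 (AugmentPass ;; ExchangePass).

Definition Passes : cmd := Pass ;; iter 5 Rep Pass.

Section Table.
Variable inp : seq nat.
Local Notation N := (size inp).+1.
Local Notation mates := {ffun 'I_N -> 'I_N}.
Local Notation table := {ffun 'I_(N ^ 4) -> {ffun 'I_N -> 'I_N}}.
Variable R : nat -> 'I_N.
Implicit Types (s : state) (c : cmd) (m r : mates) (T : table).
Implicit Types (q : 'I_(N ^ 4)) (t : 4.-tuple 'I_N) (ds : seq 'I_N).
Local Notation edge := (walk_edge R).

Lemma slot_lt t : code t < N ^ 4.
Proof. by rewrite -[X in N ^ X](size_tuple t) code_lt. Qed.

Definition slot t : 'I_(N ^ 4) := Ordinal (slot_lt t).

Lemma slot_inj : injective slot.
Proof.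
move=> t t' /(congr1 val) /= eq_code; apply: val_inj.
by apply: code_inj eq_code; rewrite !size_tuple.
Qed.

Definition valid_table T : Prop :=
  (forall q, matching edge (T q)) /\ (forall t, [set v in t] \subset unmatched (T (slot t))).

Record table_at s T : Prop := TableAt {
  walk_stored : forall p, arr s aWalk p = R p;
  table_stored : forall q (v : 'I_N), arr s aTable (q * N + v) = T q v;
  table_valid : valid_table T }.

Definition improves T T0 : Prop :=
  forall q, T q = T0 q \/ #|unmatched (T q)| < #|unmatched (T0 q)|.

Lemma improves_refl T : improves T T.
Proof. by left. Qed.

Lemma improves_trans T1 T2 T3 : improves T1 T2 -> improves T2 T3 -> improves T1 T3.
Proof.
move=> imp12 imp23 q; case: (imp12 q) => [->//|lt12]; right.
by case: (imp23 q) => [<-//|]; apply: ltn_trans.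
Qed.

Lemma improves_anti T1 T2 : improves T1 T2 -> improves T2 T1 -> T1 = T2.
Proof.
move=> imp12 imp21; apply/ffunP => q; case: (imp12 q) => // lt12.
by case: (imp21 q) => [->//|/(ltn_trans lt12)]; rewrite ltnn.
Qed.

Lemma improves_le T T0 q : improves T T0 -> #|unmatched (T q)| <= #|unmatched (T0 q)|.
Proof. by move/(_ q) => [->//|/ltnW]. Qed.

(* [P] collects what a computation establishes about [T0] unless it improves the table. *)
Definition progress T0 (P : Prop) s : Prop :=
  exists T, [/\ table_at s T, improves T T0 & T = T0 -> P].

Lemma table_at_frame L s s' T : agree L s s' -> aWalk \notin L -> aTable \notin L ->
  table_at s T -> table_at s' T.
Proof. by move=> ag aR aT [sR sT vT]; split=> // *; rewrite ag. Qed.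

Lemma progress_frame L T P s s' : agree L s s' -> aWalk \notin L -> aTable \notin L ->
  progress T P s -> progress T P s'.
Proof.
move=> ag aR aT [T1 [sT1 imp TP]]; exists T1; split=> //.
exact: table_at_frame ag aR aT sT1.
Qed.

Lemma progress_refl T s : table_at s T -> progress T True s.
Proof. by exists T; split=> //; apply: improves_refl. Qed.

Lemma progress_imp T (P Q : Prop) s : (P -> Q) -> progress T P s -> progress T Q s.
Proof. by move=> PQ [T1 [sT1 imp TP]]; exists T1; split=> // /TP/PQ. Qed.

Lemma progress_bind T0 (P : Prop) (Q : table -> Prop) s s' :
  progress T0 P s -> (forall T, table_at s T -> progress T (Q T) s') ->
  progress T0 (P /\ Q T0) s'.
Proof.
move=> [T1 [sT1 imp10 P10]] /(_ T1 sT1)[T2 [sT2 imp21 Q21]].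
exists T2; split=> // [|eq20]; first exact: improves_trans imp10.
have eq10 : T1 = T0 by apply: improves_anti imp10 _; rewrite -eq20.
by split; [apply: P10 | rewrite -eq10; apply: Q21; rewrite eq20].
Qed.

Lemma progress_for x k stp st c (Q : nat -> table -> Prop) s T0 :
  (forall s', eval inp stp s' = st) -> x \notin mods c -> x \notin [:: aWalk; aTable] ->
  table_at s T0 ->
  (forall i s' T, i < N ^ k -> agree (x :: mods c) s s' -> arr s' x 0 = i * st ->
     table_at s' T -> progress T (Q i T) (sem inp c s')) ->
  progress T0 (forall i, i < N ^ k -> Q i T0) (sem inp (For x k stp c) s).
Proof.
move=> stpE xc; rewrite !inE => /norP[xR xT] sT0 cQ.
apply: (for_rule (I := fun i => progress T0 (forall j, j < i -> Q j T0))) stpE xc _ _ _.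
- by move=> i s' v; apply: (progress_frame (@agree_set1 s' x 0 v)); rewrite inE eq_sym.
- exact: progress_imp (progress_refl sT0).
move=> i s' ik ag s'i Qi; apply: progress_imp (progress_bind Qi (fun T => cQ i s' T ik ag s'i)).
by move=> [Qlt Qeq] j; rewrite ltnS leq_eqVlt => /predU1P[->|/Qlt].
Qed.

Lemma progress_for_vertex x c (Q : 'I_N -> table -> Prop) s T0 :
  x \notin mods c -> x \notin [:: aWalk; aTable] -> table_at s T0 ->
  (forall (v : 'I_N) s' T, agree (x :: mods c) s s' -> arr s' x 0 = v -> table_at s' T ->
     progress T (Q v T) (sem inp c s')) ->
  progress T0 (forall v, Q v T0) (sem inp (ForVertex x c) s).
Proof.
move=> xc xT sT0 cQ; pose Qnat i T := forall v : 'I_N, v = i :> nat -> Q v T.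
have := @progress_for x 1 (Const 1) 1 c Qnat s T0 (fun _ => erefl) xc xT sT0.
rewrite expn1 => progQ.
apply: progress_imp (progQ _) => [allQ v|i s' T iN ag]; first exact: allQ (ltn_ord v) _ erefl.
rewrite muln1 => s'i s'T; apply: progress_imp (cQ (Ordinal iN) s' T ag s'i s'T) => Qi v v_i.
by have -> : v = Ordinal iN by apply: val_inj.
Qed.

Lemma progress_for_slot x c (Q : 'I_(N ^ 4) -> table -> Prop) s T0 :
  x \notin mods c -> x \notin [:: aWalk; aTable] -> table_at s T0 ->
  (forall q s' T, agree (x :: mods c) s s' -> arr s' x 0 = q * N -> table_at s' T ->
     progress T (Q q T) (sem inp c s')) ->
  progress T0 (forall q, Q q T0) (sem inp (ForSlot x c) s).
Proof.
move=> xc xT sT0 cQ; pose Qnat i T := forall q : 'I_(N ^ 4), q = i :> nat -> Q q T.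
have := @progress_for x 4 (Successor Len) N c Qnat s T0 (fun _ => addn1 _) xc xT sT0 => progQ.
apply: progress_imp (progQ _) => [allQ q|i s' T iN ag s'i s'T].
  exact: allQ (ltn_ord q) _ erefl.
apply: progress_imp (cQ (Ordinal iN) s' T ag s'i s'T) => Qi q q_i.
by have -> : q = Ordinal iN by apply: val_inj.
Qed.

Definition stores s a m : Prop := forall v : 'I_N, arr s a v = m v.

Lemma stores_frame L s s' a m : agree L s s' -> a \notin L -> stores s a m -> stores s' a m.
Proof. by move=> ag aL sm v; rewrite ag. Qed.

Lemma mark_keys_spec xs ds s i : aAvoid \notin xs -> valuation xs ds s ->
  arr (sem inp (MarkKeys xs) s) aAvoid i =
    if i \in [seq nat_of_ord d | d <- ds] then 1 else arr s aAvoid i.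
Proof.
elim: xs ds s => [|x xs IH] ds s; first by case: ds.
case: ds => [|d ds] //; rewrite inE negb_or => /andP[ax axs] [sx sxs]; rewrite /= sx.
rewrite (IH ds) //; last first.
  rewrite /valuation -sxs; apply/eq_in_map => y yxs /=.
  by rewrite ifN //; apply/nandP; left; apply: contraNneq axs => <-.
by rewrite /= inE; case: (i == d :> nat); rewrite ?if_same.
Qed.

Lemma mark_avoided_spec s ds (v : 'I_N) : valuation key_vars ds s ->
  (0 < arr (sem inp MarkAvoided s) aAvoid v) = (v \in ds).
Proof.
move=> s_ds; rewrite /MarkAvoided sem_seq (@mark_keys_spec _ ds) //.
  by rewrite (mem_map (@ord_inj _)) (@fill_vertex _ _ _ _ (fun _ => 0)) //; case: ifP.
rewrite /valuation -s_ds; apply/eq_in_map => x; rewrite !inE.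
by case/or4P=> /eqP->; rewrite sem_frame.
Qed.

Lemma restrict_candidate_spec s (X : {set 'I_N}) m : stores s aCand m ->
  (forall v : 'I_N, (0 < arr s aAvoid v) = (v \in X)) ->
  stores (sem inp RestrictCandidate s) aRestr (restrict X m).
Proof.
move=> sm sX; apply: (fill_if_vertex (F := fun v => restrict X m v)) => // v s' ag s'v.
rewrite holdsE /holds /= s'v !ag // sm !sX ffunE.
by case: ifP => _ //=; rewrite s'v ?ag.
Qed.

Lemma count_pairs_spec s a mate m : a != vIdx ->
  (forall (v : 'I_N) s', agree [:: vIdx; a] s s' -> arr s' vIdx 0 = v -> eval inp mate s' = m v) ->
  arr (sem inp (CountPairs a mate) s) a 0 = #|[pred v : 'I_N | v < m v]|.
Proof.
by move=> aI mateE; apply: count_card => // v s' ag s'v; rewrite holdsE /= s'v (mateE v).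
Qed.

Definition set_slot T q r : table := [ffun q' => if q' == q then r else T q'].

Lemma set_slot_valid T t r : valid_table T -> matching edge r -> [set v in t] \subset unmatched r ->
  valid_table (set_slot T (slot t) r).
Proof.
move=> [TM Tt] rM rt; split=> [q|t']; rewrite ffunE; first by case: ifP.
by rewrite (inj_eq slot_inj); case: eqP => [->|].
Qed.

Lemma compare_sizes_spec s T q r : table_at s T -> arr s vSlot 0 = q * N -> stores s aRestr r ->
  [/\ agree [:: vIdx; vNew; vOld] s (sem inp CompareSizes s),
      arr (sem inp CompareSizes s) vNew 0 = #|[pred v : 'I_N | v < r v]|
    & arr (sem inp CompareSizes s) vOld 0 = #|[pred v : 'I_N | v < T q v]|].
Proof.
move=> sT s_slot sr; split.
- by apply: agree_sub (@sem_frame inp _ s); apply/allP.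
- rewrite sem_seq sem_frame //; apply: count_pairs_spec => // v s' ag s'v.
  by rewrite /= s'v ag.
- rewrite sem_seq; apply: count_pairs_spec => // v s' ag s'v.
  by rewrite /= s'v !ag // !sem_frame // s_slot (table_stored sT).
Qed.

Lemma keep_better_progress s T t r : table_at s T -> arr s vSlot 0 = slot t * N ->
  stores s aRestr r -> matching edge r -> [set v in t] \subset unmatched r ->
  progress T (#|unmatched (T (slot t))| <= #|unmatched r|) (sem inp KeepBetter s).
Proof.
move=> sT s_slot sr rM rt; rewrite /KeepBetter sem_seq sem_when.
case: (compare_sizes_spec sT s_slot sr); move: (sem inp CompareSizes s) => s' ag newE oldE.
have -> : holds inp (Less (Var vOld) (Var vNew)) s' =
    (#|unmatched r| < #|unmatched (T (slot t))|).
  have [TM _] := table_valid sT.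
  by rewrite holdsE /= newE oldE -ltn_card_unmatched //; [case: rM | case: (TM (slot t))].
case: ltnP => [better|no_better]; last first.
  by exists T; split=> //; [apply: table_at_frame ag _ _ sT | apply: improves_refl].
exists (set_slot T (slot t) r); split=> [|q|eqT].
- split=> [p|q v|]; last exact: set_slot_valid (table_valid sT) rM rt.
    by rewrite sem_frame // ag // (walk_stored sT).
  rewrite (@fill_block _ _ _ _ _ (slot t) (fun v => r v)) // => [|s'' ag'|w s'' ag' s''w].
  + by rewrite ffunE ag // (table_stored sT) val_eqE; case: ifP.
  + by rewrite /= ag' // ag.
  + by rewrite /= s''w ag' // ag.
- by rewrite ffunE; case: eqP => [->|]; [right | left].
- have /ffunP/(_ (slot t)) := eqT; rewrite ffunE eqxx => eq_r.
  by rewrite eq_r ltnn in better.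
Qed.

Lemma offer_progress s T t m : table_at s T -> valuation key_vars t s ->
  arr s vSlot 0 = slot t * N -> stores s aCand m -> matching edge m ->
  progress T (#|unmatched (T (slot t))| <= #|unmatched (restrict [set v in t] m)|)
    (sem inp Offer s).
Proof.
move=> sT s_t s_slot sm mM; rewrite /Offer 2!sem_seq.
have avoid := mark_avoided_spec _ s_t.
have ag := @sem_frame inp MarkAvoided s; move: (sem inp MarkAvoided s) avoid ag => s1 avoid ag1.
have ag2 := @sem_frame inp RestrictCandidate s1.
have sm1 : stores s1 aCand m by apply: stores_frame ag1 _ sm.
have restr : stores (sem inp RestrictCandidate s1) aRestr (restrict [set v in t] m).
  by apply: restrict_candidate_spec sm1 _ => v; rewrite avoid inE.
apply: keep_better_progress restr _ _.
- exact: table_at_frame ag2 _ _ (table_at_frame ag1 _ _ sT).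
- by rewrite ag2 // ag1.
- exact: restrict_matching.
- exact: restrict_avoids.
Qed.

Definition dominates T m : Prop :=
  forall t, #|unmatched (T (slot t))| <= #|unmatched (restrict [set v in t] m)|.

Definition dominates_below k T m : Prop := forall t, slot t < k ->
  #|unmatched (T (slot t))| <= #|unmatched (restrict [set v in t] m)|.

Lemma offer_below s T t m : progress T (dominates_below (slot t) T m) s ->
  valuation key_vars t s -> arr s vSlot 0 = slot t * N -> stores s aCand m -> matching edge m ->
  progress T (dominates_below (slot t).+1 T m) (sem inp Offer s).
Proof.
move=> pr s_t s_slot sm mM; apply: progress_imp (progress_bind pr (fun T1 sT1 =>
  offer_progress sT1 s_t s_slot sm mM)) => -[dom dom_t] t'.
by rewrite ltnS leq_eqVlt => /orP[/eqP/val_inj/slot_inj->|]; last exact: dom.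
Qed.

Lemma register_progress s T m : table_at s T -> stores s aCand m -> matching edge m ->
  progress T (dominates T m) (sem inp Register s).
Proof.
move=> sT sm mM.
pose I k s' :=
  [/\ progress T (dominates_below k T m) s', stores s' aCand m & arr s' vSlot 0 = k * N].
suff [+ _ _] : I (N ^ size key_vars) (sem inp Register s).
  by apply: progress_imp => dom t; apply/dom/ltn_ord.
rewrite /Register sem_seq; apply: nest_rule => //.
- by move=> x; rewrite !inE => /or4P[]/eqP->.
- move=> k x s' v x_key [pr s'm s'_slot].
  have ag := @agree_set1 s' x 0 v; move: x_key; rewrite !inE => x_key.
  split; [apply: progress_frame ag _ _ pr|apply: stores_frame ag _ s'm|rewrite ag //];
    by case/or4P: x_key => /eqP->.
- split=> //; apply: progress_imp (progress_refl _) => //.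
  exact: table_at_frame (@agree_set1 s vSlot 0 0) _ _ sT.
move=> ds s' size_ds s'ds [pr s'm s'_slot].
have size_ds4 : size ds == 4 by rewrite size_ds.
have pr1 := offer_below (t := Tuple size_ds4) pr s'ds s'_slot s'm mM.
have ag := @sem_frame inp Offer s'; rewrite sem_seq sem_assign.
have s'_slot1 : arr (sem inp Offer s') vSlot 0 = code ds * N by rewrite ag.
move: (sem inp Offer s') ag pr1 s'_slot1 => s1 ag pr1 s1_slot.
split.
- exact: progress_frame (@agree_set1 s1 vSlot 0 _) _ _ pr1.
- by apply: stores_frame (@agree_set1 s1 vSlot 0 _) _ (stores_frame ag _ s'm).
- by rewrite /= s1_slot addn1 mulSn addnC.
Qed.

Definition augment g m : mates :=
  if [&& R g != R g.+1, R g != ord0, R g.+1 != ord0, m (R g) == R g & m (R g.+1) == R g.+1]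
  then add_edge m (R g) (R g.+1) else m.

Definition exchanged m m' (v : 'I_N) : {set 'I_N} :=
  if (m v == v) || (m' v == v) then alternating m m' v else set0.

Definition exchange m m' v : mates := switch (exchanged m m' v) m m'.

Lemma exchange_id m v : exchange m m v = m.
Proof. by apply/ffunP => u; rewrite ffunE if_same. Qed.

Lemma augment_matching (g : 'I_N) m : matching edge m -> matching edge (augment g m).
Proof.
move=> mM; rewrite /augment; case: ifP => // /and5P[uv u0 v0 /eqP mu /eqP mv].
apply: add_edge_matching => //; first exact: walk_edge_sym.
rewrite /walk_edge uv u0 v0; apply/existsP; exists g.
by rewrite /joins !eqxx.
Qed.

Lemma exchange_matching m m' v : matching edge m -> matching edge m' ->
  matching edge (exchange m m' v).
Proof.
move=> mM m'M; rewrite /exchange /exchanged; case: ifP => [/orP fixv|_].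
  by apply: switch_alternating_matching => //; case: fixv => /eqP; [left | right].
by apply: switch_matching => // x; rewrite inE.
Qed.

Lemma add_edge_spec s T q (g : 'I_N) : table_at s T -> arr s vSlot1 0 = q * N ->
  arr s vEdge 0 = g -> stores (sem inp AddEdge s) aCand (augment g (T q)).
Proof.
move=> sT s_slot sg; rewrite /AddEdge sem_seq sem_when.
have s1m : stores (sem inp CopyMates s) aCand (T q).
  apply: (fill_vertex (F := fun v => T q v)) => // v s' ag s'v.
  by rewrite /= s'v !ag // s_slot (table_stored sT).
have ag := @sem_frame inp CopyMates s.
move: (sem inp CopyMates s) s1m ag => s1 s1m ag.
have [s1U s1W] : eval inp EdgeStart s1 = R g /\ eval inp EdgeEnd s1 = R g.+1.
  by rewrite /= !ag // sg addn1 !(walk_stored sT).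
have candE e (v : 'I_N) : eval inp e s1 = v -> eval inp (Get aCand e) s1 = T q v.
  by rewrite /= => ->; apply: s1m.
have -> : holds inp EdgeFree s1 =
    [&& R g != R g.+1, R g != ord0, R g.+1 != ord0, T q (R g) == R g & T q (R g.+1) == R g.+1].
  by rewrite !holdsE /holds (candE _ _ s1U) (candE _ _ s1W) s1U s1W !lt0n.
rewrite /augment; case: ifP => // _ v; rewrite /= in s1U s1W.
by rewrite add_edgeC /= s1U s1W s1m ffunE !val_eqE; do 2!case: ifP => // _.
Qed.

Lemma mark_component_spec s T q q' (v w : 'I_N) : table_at s T ->
  arr s vSlot1 0 = q * N -> arr s vSlot2 0 = q' * N -> arr s vStart 0 = v ->
  (forall u : 'I_N, arr s aMark u = 0) ->
  (0 < arr (sem inp MarkComponent s) aMark w) = (w \in alternating (T q) (T q') v).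
Proof.
move=> sT s_q s_q' sv mark0; rewrite /MarkComponent sem_seq sem_assign.
pose f := T q \o T q'.
pose I k s' := arr s' vCur 0 = iter k f v /\
  forall u : 'I_N, (0 < arr s' aMark u) = (u \in traject f v k).
set s0 := set_arr _ _ _ _; suff [_ marked] : I N (sem inp (ForVertex vScan MarkNext) s0).
  by rewrite mem_alternating card_ord marked.
apply: for_vertex_rule => //.
  by split=> [|u]; rewrite /= ?sv ?mark0.
move=> k s' ag _ [cur marked]; split=> [|u].
  by rewrite /= cur !ag //= s_q s_q' !(table_stored sT).
rewrite trajectSr mem_rcons inE -marked /= cur val_eqE.
by case: (u == _).
Qed.

Lemma mark_exchanged_spec s T q q' (v w : 'I_N) : table_at s T ->
  arr s vSlot1 0 = q * N -> arr s vSlot2 0 = q' * N -> arr s vStart 0 = v ->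
  (0 < arr (sem inp MarkExchanged s) aMark w) = (w \in exchanged (T q) (T q') v).
Proof.
move=> sT s_q s_q' sv; rewrite /MarkExchanged sem_seq sem_when.
have mark0 : forall u : 'I_N, arr (sem inp (Fill aMark (Const 0) (Const 0)) s) aMark u = 0.
  exact: (fill_vertex (F := fun _ => 0)).
have ag := @sem_frame inp (Fill aMark (Const 0) (Const 0)) s.
move: (sem inp (Fill aMark _ _) s) mark0 ag => s0 mark0 ag.
have s0T : table_at s0 T by apply: table_at_frame ag _ _ sT.
have [s0_q s0_q' s0v] :
    [/\ arr s0 vSlot1 0 = q * N, arr s0 vSlot2 0 = q' * N & arr s0 vStart 0 = v].
  by rewrite !ag.
have -> : holds inp StartFree s0 = (T q v == v) || (T q' v == v).
  by rewrite !holdsE /= s0_q s0_q' s0v !(table_stored s0T).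
rewrite /exchanged; case: ifP => _; first exact: mark_component_spec.
by rewrite mark0 inE.
Qed.

Lemma exchange_spec s T q q' (v : 'I_N) : table_at s T ->
  arr s vSlot1 0 = q * N -> arr s vSlot2 0 = q' * N -> arr s vStart 0 = v ->
  stores (sem inp Exchange s) aCand (exchange (T q) (T q') v).
Proof.
move=> sT s_q s_q' sv; rewrite /Exchange sem_seq.
have marked u := mark_exchanged_spec u sT s_q s_q' sv.
have ag_mark := @sem_frame inp MarkExchanged s.
move: (sem inp MarkExchanged s) marked ag_mark => s1 marked ag_mark.
apply: (fill_if_vertex (F := fun u => exchange (T q) (T q') v u)) => // u s' ag s'u.
rewrite /holds [eval _ _ _ in X in if X then _ else _]/= s'u ag // marked ffunE.
by case: ifP => _; rewrite /= s'u !ag // !ag_mark // ?s_q ?s_q' (table_stored sT).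
Qed.

Lemma candidate_progress s T c m : aWalk \notin mods c -> aTable \notin mods c ->
  table_at s T -> stores (sem inp c s) aCand m -> matching edge m ->
  progress T (dominates T m) (sem inp (c ;; Register) s).
Proof.
move=> cR cT sT sm mM; rewrite sem_seq; apply: register_progress sm mM.
exact: table_at_frame (@sem_frame inp c s) cR cT sT.
Qed.

Definition augment_closed_at q T : Prop := forall g : 'I_N, dominates T (augment g (T q)).

Definition exchange_closed_at q T : Prop :=
  forall q' (v : 'I_N), dominates T (exchange (T q) (T q') v).

Definition closed_table T : Prop := forall q, augment_closed_at q T /\ exchange_closed_at q T.

Lemma augment_pass_progress s T q : table_at s T -> arr s vSlot1 0 = q * N ->
  progress T (augment_closed_at q T) (sem inp AugmentPass s).
Proof.
move=> sT sq.
apply: (progress_for_vertex (Q := fun g T' => dominates T' (augment g (T' q)))) => //.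
move=> g s' T' ag s'g s'T; apply: candidate_progress => //.
  by apply: add_edge_spec s'T _ s'g; rewrite ag.
by apply: augment_matching; case: (table_valid s'T).
Qed.

Lemma exchange_pass_progress s T q : table_at s T -> arr s vSlot1 0 = q * N ->
  progress T (exchange_closed_at q T) (sem inp ExchangePass s).
Proof.
move=> sT sq; apply: (progress_for_slot
  (Q := fun q' T' => forall v : 'I_N, dominates T' (exchange (T' q) (T' q') v))) => //.
move=> q' s1 T1 ag1 s1q' s1T.
apply: (progress_for_vertex (Q := fun v T' => dominates T' (exchange (T' q) (T' q') v))) => //.
move=> v s' T' ag s'v s'T; apply: candidate_progress => //.
  by apply: exchange_spec s'T _ _ s'v; rewrite ag // ag1.
by apply: exchange_matching; case: (table_valid s'T).
Qed.

Lemma pass_progress s T : table_at s T -> progress T (closed_table T) (sem inp Pass s).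
Proof.
move=> sT.
apply: (progress_for_slot
  (Q := fun q T' => augment_closed_at q T' /\ exchange_closed_at q T')) => //.
move=> q s1 T1 _ s1q s1T; rewrite sem_seq.
apply: progress_bind (augment_pass_progress s1T s1q) _ => T2 s2T.
by apply: exchange_pass_progress => //; rewrite sem_frame.
Qed.

(* Padding with the null vertex, which every matching leaves unmatched, is no restriction. *)
Lemma restrict_tuple (X : {set 'I_N}) : #|X| <= 4 -> exists2 t : 4.-tuple 'I_N,
  X \subset ord0 |: [set v in t] &
  forall m, matching edge m -> restrict [set v in t] m = restrict X m.
Proof.
move=> X4; pose t := [tuple nth ord0 (enum X) i | i < 4].
have tX : ord0 |: [set v in t] = ord0 |: X.
  apply/setP => v; rewrite !in_setU1 inE; case: eqP => //= v0.
  apply/mapP/idP => [[i _ def_v]|vX].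
    rewrite -mem_enum def_v mem_nth // ltnNge.
    by apply/negP => size_le; rewrite nth_default in def_v.
  have vs : v \in enum X by rewrite mem_enum.
  have iX : index v (enum X) < 4 by rewrite (leq_trans _ X4) // cardE index_mem.
  by exists (Ordinal iX); rewrite ?mem_enum //= nth_index.
exists t => [|m mM]; first by rewrite tX subsetUr.
have [m0 mK] := (null_unmatched mM, proj1 mM).
by rewrite -(restrictU1 _ mK m0) tX restrictU1.
Qed.

Definition null_slot : 'I_(N ^ 4) := slot [tuple of nseq 4 ord0].

Definition family T : {set mates} := [set T q | q : 'I_(N ^ 4)].

Lemma mem_family T q : T q \in family T.
Proof. exact: imset_f. Qed.

Lemma familyP T m : reflect (exists q, m = T q) (m \in family T).
Proof. by apply: (iffP imsetP) => [[q _ ->]|[q ->]]; exists q. Qed.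

Lemma dominates_absorbs T m : valid_table T -> matching edge m -> dominates T m ->
  absorbs (family T) m.
Proof.
move=> [TM Tt] mM dom X /restrict_tuple[t Xt restr_t].
exists (T (slot t)); rewrite ?mem_family //; split; last by rewrite -restr_t.
apply: subset_trans Xt _; rewrite subUset Tt andbT sub1set.
by apply/unmatchedP/(null_unmatched (TM _)).
Qed.

Lemma closed_table_family T : valid_table T -> closed_table T -> closed_family edge (family T).
Proof.
move=> vT cT; have [TM _] := vT.
split=> [m /familyP[q ->]|m /familyP[q ->]|m u v /familyP[q ->] uv mu mv|m m' v].
- exact: TM.
- apply: dominates_absorbs => //; have [_ /(_ q ord0)] := cT q.
  by rewrite exchange_id.
- apply: dominates_absorbs => //; first by apply: add_edge_matching => //; apply: walk_edge_sym.
  have /and4P[neq_uv u0 v0 /existsP[g joins_uv]] := uv; have [/(_ g) + _] := cT q.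
  rewrite /augment; case/orP: joins_uv => /andP[/eqP-> /eqP->].
    by rewrite neq_uv u0 v0 mu mv !eqxx.
  by rewrite eq_sym neq_uv u0 v0 mu mv !eqxx add_edgeC.
- move=> /familyP[q ->] /familyP[q' ->] fixv; apply: dominates_absorbs => //.
    exact: switch_alternating_matching.
  have [_ /(_ q' v)] := cT q; rewrite /exchange /exchanged.
  by have -> : (T q v == v) || (T q' v == v) by case: fixv => ->; rewrite eqxx ?orbT.
Qed.

Lemma closed_table_maximum T m : valid_table T -> closed_table T -> matching edge m ->
  #|unmatched (T null_slot)| <= #|unmatched m|.
Proof.
move=> vT cT; have [TM _] := vT.
apply: (closed_family_maximum _ _ (closed_table_family vT cT) (mem_family _ _)).
- exact: walk_edge_sym.
- exact: walk_edge_irr.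
move=> _ /familyP[q ->]; have [_ /(_ q ord0)] := cT q; rewrite exchange_id.
move/(_ [tuple of nseq 4 ord0]); rewrite restrict_id //; first by case: (TM q).
apply/subsetP => v; rewrite inE /= !inE !orbb => /eqP->.
by rewrite (null_unmatched (TM q)).
Qed.

Definition total_unmatched T : nat := \sum_q #|unmatched (T q)|.

Lemma total_unmatched_le T : total_unmatched T <= N ^ 5.
Proof.
rewrite (expnSr N 4) -[X in X * _](card_ord (N ^ 4)) -sum_nat_const.
by apply: leq_sum => q _; apply: leq_trans (max_card _) _; rewrite card_ord.
Qed.

Lemma improves_total T T0 : improves T T0 -> T = T0 \/ total_unmatched T < total_unmatched T0.
Proof.
move=> imp; case: (pickP (fun q => T q != T0 q)) => [q neq_q|eqT]; last first.
  by left; apply/ffunP => q; apply/eqP; rewrite -[_ == _]negbK eqT.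
right; rewrite /total_unmatched (bigD1 q) //= [X in _ < X](bigD1 q) //= -addSn leq_add //.
  by case: (imp q) => // eq_q; rewrite eq_q eqxx in neq_q.
by apply: leq_sum => q' _; apply: improves_le.
Qed.

Lemma iter_pass k s T : table_at s T -> exists T',
  [/\ table_at (iter k (sem inp Pass) s) T', improves T' T &
    (exists T1, [/\ valid_table T1, closed_table T1 & improves T' T1])
    \/ total_unmatched T' + k <= total_unmatched T].
Proof.
move=> sT; elim: k => [|k [T1 [sT1 imp1 closed1]]].
  by exists T; split=> //; [apply: improves_refl | right; rewrite addn0].
have [T2 [sT2 imp2 closed2]] := pass_progress sT1.
exists T2; split; [by [] | exact: improves_trans imp1 |].
case: closed1 => [[T0 [vT0 cT0 imp0]]|total1].
  by left; exists T0; split=> //; apply: improves_trans imp0.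
case: (improves_total imp2) => [eqT|total2]; last first.
  by right; apply: leq_trans total1; rewrite addnS -addSn leq_add2r.
by left; exists T1; split=> //; [apply: table_valid sT1 | apply: closed2].
Qed.

Lemma passes_spec s T : table_at s T -> exists T', table_at (sem inp Passes s) T' /\
  forall m, matching edge m -> #|unmatched (T' null_slot)| <= #|unmatched m|.
Proof.
move=> sT; rewrite /Passes sem_seq sem_iter_rep -iterSr.
have [T' [sT' _ closed]] := iter_pass (N ^ 5).+1 sT; exists T'; split=> // m mM.
case: closed => [[T1 [vT1 cT1 imp1]]|total].
  exact: leq_trans (improves_le _ imp1) (closed_table_maximum vT1 cT1 mM).
by have := leq_trans total (total_unmatched_le T); rewrite addnS ltnNge leq_addl.
Qed.

End Table.

(** * The attractor program *)

Notation aOut := 20 (only parsing).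
Notation vPos := 21 (only parsing).
Notation vLast := 22 (only parsing).

Definition Predecessor (e : expr) : expr := Minus e (Const 1).

Definition ValidPosition (e : expr) : expr := And (Less (Const 0) e) (Less e Len).

Definition Occurs (p q : expr) : expr :=
  And (ValidPosition q) (And (ValidPosition p)
    (And (Equal (Input (Predecessor q)) (Input (Predecessor p))) (Equal (Input q) (Input p)))).

Definition StoreBigram : cmd :=
  Assign vLast (Const 0) ;;
  FindLast vLast (Occurs (Var vPos) (Var vScan)) (Var vScan) ;;
  Store aWalk (Var vPos) (Var vLast).

Definition StoreBigrams : cmd := ForVertex vPos StoreBigram.

Definition InitTable : cmd := ForSlot vSlot (Fill aTable (Var vSlot) (Var vIdx)).

(* The first slot of the table is the one that avoids the null vertex only. *)
Definition ReadMatching : cmd := Fill aCand (Const 0) (Get aTable (Var vIdx)).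

Definition Joins (g u v : expr) : expr :=
  Or (And (Equal (Get aWalk g) u) (Equal (Get aWalk (Successor g)) v))
     (And (Equal (Get aWalk g) v) (Equal (Get aWalk (Successor g)) u)).

Definition MarkPosition : cmd :=
  Assign vLast (Var vPos) ;;
  FindLast vLast (Joins (Var vScan) (Var vPos) (Get aCand (Var vPos))) (Successor (Var vScan)) ;;
  Store aOut (Var vLast) (Const 1).

Definition Selected (v : expr) : expr :=
  And (And (Less (Const 0) v) (Equal (Get aWalk v) v)) (Not (Less (Get aCand v) v)).

Definition MarkPositions : cmd := ForVertex vPos (When (Selected (Var vPos)) MarkPosition).

Definition Output : cmd := ForVertex vPos (When (Get aOut (Var vPos)) (Write (Var vPos))).

Definition Attractor : cmd :=
  StoreBigrams ;; InitTable ;; Passes ;; ReadMatching ;; MarkPositions ;; Output.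

Section Attractor.
Variable inp : seq nat.
Local Notation n := (size inp).
Local Notation N := (size inp).+1.
Implicit Types (s : state) (m : {ffun 'I_N -> 'I_N}).

Lemma store_bigram_spec s (p : 'I_N) q : arr s vPos 0 = p ->
  arr (sem inp StoreBigram s) aWalk q = if q == p then nat_of_ord (bigram inp p) else arr s aWalk q.
Proof.
move=> sp; rewrite /StoreBigram 2!sem_seq.
set s1 := sem inp (FindLast _ _ _) _.
have s1_last : arr s1 vLast 0 = bigram inp p.
  rewrite /s1 (find_last (P := occurs inp p) (f := id)) // ?map_id ?bigramE // => q' s' ag s'q'.
  by rewrite (occurs_nth inp 0) !holdsE /= s'q' ag //= sp subn1 subn1 !andbA.
have s1p : arr s1 vPos 0 = p by rewrite /s1 sem_frame.
have s1_walk : arr s1 aWalk q = arr s aWalk q by rewrite /s1 sem_frame.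
by move: s1 s1_last s1p s1_walk => s1 s1_last s1p s1_walk; rewrite /= s1_last s1p s1_walk.
Qed.

Lemma store_bigrams_spec s p : (forall q, arr s aWalk q = 0) ->
  arr (sem inp StoreBigrams s) aWalk p = bigram inp p.
Proof.
move=> walk0.
pose I k s' := forall q, arr s' aWalk q = if q < k then nat_of_ord (bigram inp q) else 0.
suff filled : I N (sem inp StoreBigrams s).
  by rewrite filled; case: ltnP => // /ltnW/(bigram_end (S := inp))->.
apply: for_vertex_rule => //.
move=> q s' _ s'q Iq r; rewrite (store_bigram_spec _ s'q) Iq ltnS [r <= q]leq_eqVlt.
by case: eqVneq => [->|_].
Qed.

Lemma init_table_spec s : (forall p, arr s aWalk p = bigram inp p) ->
  table_at (bigram inp) (sem inp InitTable s) [ffun _ => [ffun v => v]].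
Proof.
move=> sR; split=> [p|q v|]; first by rewrite sem_frame.
- rewrite !ffunE; pose I k s' :=
    forall (q : 'I_(N ^ 4)) (v : 'I_N), q < k -> arr s' aTable (q * N + v) = v.
  suff filled : I (N ^ 4) (sem inp InitTable s) by apply: filled.
  apply: for_slot_rule => //.
  move=> k s' _ s'k Ik q' w; rewrite ltnS leq_eqVlt.
  rewrite (@fill_block _ _ _ _ _ k (fun v => v)) // => [|s'' ag].
    by case: eqP => //= _; apply: Ik.
  by rewrite /= ag.
- split=> [q|t]; rewrite ffunE; first exact: matching_id.
  by apply/subsetP => v _; rewrite inE ffunE.
Qed.

Lemma read_matching_spec s T : table_at (bigram inp) s T ->
  stores (sem inp ReadMatching s) aCand (T (null_slot inp)).
Proof.
move=> sT; apply: (fill_vertex (F := fun v => T (null_slot inp) v)) => // v s' ag s'v.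
by rewrite /= s'v ag // -(table_stored sT).
Qed.

Lemma mark_position_spec s m (v : 'I_N) p : arr s vPos 0 = v ->
  (forall q, arr s aWalk q = bigram inp q) -> stores s aCand m ->
  arr (sem inp MarkPosition s) aOut p =
    if p == chosen (bigram inp) v (m v) then 1 else arr s aOut p.
Proof.
move=> sv sR sm; rewrite /MarkPosition 2!sem_seq.
set s1 := sem inp (FindLast _ _ _) _.
have s1_last : arr s1 vLast 0 = chosen (bigram inp) v (m v).
  rewrite /s1 (find_last (P := fun g => joins (bigram inp) g v (m v)) (f := succn)) //=.
    by rewrite sv.
  move=> g s' ag s'g; rewrite !holdsE /= s'g addn1 !ag //= sv !sR sm.
  by rewrite !val_eqE.
have s1_out : arr s1 aOut p = arr s aOut p by rewrite /s1 sem_frame.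
by move: s1 s1_last s1_out => s1 s1_last s1_out; rewrite /= s1_last s1_out.
Qed.

Lemma mark_positions_spec s m p : (forall q, arr s aWalk q = bigram inp q) -> stores s aCand m ->
  (forall q, arr s aOut q = 0) ->
  (0 < arr (sem inp MarkPositions s) aOut p) =
    [exists v : 'I_N, selected (bigram inp) m v && (chosen (bigram inp) v (m v) == p)].
Proof.
move=> sR sm out0.
pose I k s' := forall q, (0 < arr s' aOut q) = [exists v : 'I_N,
  [&& v < k, selected (bigram inp) m v & chosen (bigram inp) v (m v) == q]].
suff marked : I N (sem inp MarkPositions s).
  by rewrite marked; apply: eq_existsb => v; rewrite ltn_ord.
apply: for_vertex_rule => //.
  by move=> q; rewrite out0; apply/esym/existsP => -[].
move=> v s' ag s'v Iv q; rewrite sem_when.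
have s'R r : arr s' aWalk r = bigram inp r by rewrite ag.
have s'm : stores s' aCand m by move=> w; rewrite ag.
have -> : holds inp (Selected (Var vPos)) s' = selected (bigram inp) m v.
  by rewrite !holdsE /= s'v s'R s'm -leqNgt val_eqE lt0n /selected /walk_vertex.
have -> : [exists u : 'I_N,
      [&& u < v.+1, selected (bigram inp) m u & chosen (bigram inp) u (m u) == q]] =
    (selected (bigram inp) m v && (chosen (bigram inp) v (m v) == q)) || (0 < arr s' aOut q).
  rewrite Iv; apply/existsP/orP => [[u /and3P[+ sel_u chosen_u]]|].
    rewrite ltnS leq_eqVlt => /predU1P[/val_inj <-|lt_uv]; first by left; rewrite sel_u.
    by right; apply/existsP; exists u; rewrite lt_uv sel_u.
  case=> [/andP[sel_v chosen_v]|/existsP[u]]; first by exists v; rewrite ltnSn sel_v.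
  by case/andP=> lt_uv sel_u; exists u; rewrite ltnW.
case: ifP => // _; rewrite (mark_position_spec _ s'v s'R s'm) eq_sym.
by case: ifP.
Qed.

Lemma output_spec s :
  out (sem inp Output s) = out s ++ [seq p <- iota 0 N | 0 < arr s aOut p].
Proof.
pose I k s' := out s' = out s ++ [seq p <- iota 0 k | 0 < arr s aOut p].
apply: (for_vertex_rule (I := I)); rewrite /I ?cats0 //.
move=> p s' ag s'p s'_out.
rewrite sem_when -(addn1 p) iotaD filter_cat catA -s'_out /holds /= s'p ag //.
by case: ifP => _ /=; rewrite ?s'p ?cats1 ?cats0.
Qed.

Lemma attractor_spec : exists m, [/\ matching (walk_edge (bigram inp)) m,
  forall m', matching (walk_edge (bigram inp)) m' -> #|unmatched m| <= #|unmatched m'|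
  & out (sem inp Attractor (State (fun _ _ => 0) [::])) = positions (bigram inp) m].
Proof.
rewrite /Attractor 5!sem_seq; set s0 := State _ _; set s1 := sem inp StoreBigrams s0.
have s1R p : arr s1 aWalk p = bigram inp p by apply: store_bigrams_spec.
have [T [sT T_max]] := passes_spec (init_table_spec s1R).
set s2 := sem inp InitTable s1 in sT *; set s3 := sem inp Passes s2 in sT *.
exists (T (null_slot inp)); split=> //; first by case: (table_valid sT).
set s4 := sem inp ReadMatching s3.
rewrite output_spec !sem_silent // cat0s; apply: eq_filter => p.
apply: mark_positions_spec => [q||q].
- by rewrite /s4 sem_frame // (walk_stored sT).
- exact: read_matching_spec.
- by rewrite /s4 /s3 /s2 /s1 !sem_frame.
Qed.

End Attractor.

Theorem theorem35 : polytime_solvable (compute_minimum_sharp_attractor 2).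
Proof.
apply: (@loop_program_polytime _ Attractor 24) => // inp.
have [m [mM m_max ->]] := attractor_spec inp.
by split; [apply: positions_uniq | apply: positions_minimum_attractor].
Qed.
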